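(* Let $(r_n)_{n\ge 2}$ be a sequence of positive reals and put $\overline{\delta}_n = (n-1)\pi r_n^2$. Assume that $\overline{\delta}_n \ge 2$ for all $n$ and that $\overline{\delta}_n = o(\sqrt{n})$ as $n\to\infty$. For each $n$ let $G_n \sim \mathcal{G}(n,r_n)$ be a random geometric graph (with expected average degree $\overline{\delta}_n$), and let $F_n$ be the fraction of edges of $G_n$ that are monochrome after the Flip-Schelling-Process on $G_n$. Then there is a sequence $\varepsilon_n \to 0$ such that for all sufficiently large $n$ $$\mathrm{E}[F_n] \;\ge\; \frac{1}{2} + \frac{9}{800}\cdot\left(\frac12 - \frac{1}{\sqrt{2\pi\lfloor \overline{\delta}_n/2\rfloor}}\right)^2\cdot\left(1 - e^{-\overline{\delta}_n/2}\left(1+\frac{\overline{\delta}_n}{2}\right)\right)\cdot(1-\varepsilon_n).$$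
   Context: Random geometric graph $\mathcal{G}(n,r)$: each of $n$ vertices $v$ is independently assigned a uniformly random point $(v_1,v_2)\in[0,1]^2$, and distinct vertices $u,v$ are connected by an edge iff $\mathrm{dist}(u,v)\le r$, where $\mathrm{dist}(u,v)=\sqrt{|u_1-v_1|_\circ^2+|u_2-v_2|_\circ^2}$ and $|x-y|_\circ=\min\{|x-y|,1-|x-y|\}$ (the unit-area flat torus). Its expected average degree is $\overline{\delta}=(n-1)\pi r^2$. Flip-Schelling-Process (FSP) on a graph $G=(V,E)$: each vertex is an agent that has one of two types $t^+,t^-$; initially, types are chosen independently and uniformly at random (independently of $G$). Then all agents simultaneously and exactly once do the following, based on the initial types. Let $\delta_v$ be the degree of $v$. If more than $\delta_v/2$ neighbors of $v$ have the same type as $v$, then $v$ keeps its type; if more than $\delta_v/2$ neighbors have a different type, then $v$ changes its type; if exactly $\delta_v/2$ neighbors have a different type, $v$ changes its type with probability $\frac12$ (by an independent coin flip). An edge $\{u,v\}$ is monochrome if $u$ and $v$ have the same type. The fraction of monochrome edges is the number of monochrome edges divided by $|E|$ (set to $0$ if $E=\emptyset$). The expectation is over the random graph, the initial types and the tie-breaking coins. *)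

(* Defs.v *)
From HB Require Import structures.
From mathcomp Require Import all_boot all_order all_algebra.
From mathcomp Require Import all_classical all_reals all_analysis.

Set Implicit Arguments.
Unset Strict Implicit.
Unset Printing Implicit Defensive.

Import Order.TTheory GRing.Theory Num.Theory.
Import numFieldNormedType.Exports.

Local Open Scope classical_set_scope.
Local Open Scope ring_scope.

Section iid.
Context d (T : measurableType d) (R : realType).

Definition tuple_consf n (x : T * n.-tuple T) : n.+1.-tuple T :=
  [tuple of x.1 :: x.2].

Lemma measurable_tuple_consf n :
  measurable_fun [set: T * n.-tuple T] (@tuple_consf n).
Proof. exact: measurable_cons measurable_fst measurable_snd. Qed.

HB.instance Definition _ n :=
  isMeasurableFun.Build _ _ _ _ (@tuple_consf n) (@measurable_tuple_consf n).

(* The n-fold product of P, i.e. the law of n independent samples of P;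
   it is characterized by [iidE]. *)
Fixpoint iid (P : probability T R) (n : nat) : probability (n.-tuple T) R :=
  match n return probability (n.-tuple T) R with
  | 0 => \d_([tuple] : 0.-tuple T)
  | m.+1 => distribution (P \x iid P m)%E (@tuple_consf m)
  end.

Lemma iidE (P : probability T R) n (A : 'I_n -> set T) :
  (forall i, measurable (A i)) ->
  iid P n [set x | forall i, A i (tnth x i)] = (\prod_(i < n) P (A i))%E.
Proof.
elim: n A => [|n IH] A mA /=.
  rewrite big_ord0 diracE mem_set//=.
  by case.
rewrite big_ord_recl -IH// -product_measure1E//; last first.
  rewrite (_ : [set _ | _] = \bigcap_(i : 'I_n)
      ((fun x : n.-tuple T => tnth x i) @^-1` A (lift ord0 i))).
    apply: fin_bigcap_measurable => // i _.
    by rewrite -[X in measurable X]setTI; exact: measurable_tnth.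
  by apply/seteqP; split => x /= => [xA i _|xA i]; exact: xA.
rewrite /distribution /pushforward; congr (product_measure1 _ _ _).
apply/seteqP; split => -[x y] /=.
  move=> xyA; split; first by have := xyA ord0.
  by move=> i; have := xyA (lift ord0 i); rewrite /tuple_consf/= tnthS.
move=> [xA yA] i; case: (unliftP ord0 i) => [j|] ->; last exact: xA.
by rewrite /tuple_consf/= tnthS; exact: yA.
Qed.

End iid.

Section flip_schelling_process.
Context (V : finType) (e : rel V).

Definition neighbors (v : V) : {set V} := [set u | e v u]%SET.

Definition degree (v : V) : nat := #|neighbors v|.

Definition edges : {set {set V}} :=
  [set [set uv.1; uv.2] | uv : V * V & e uv.1 uv.2]%SET.

(* [t] gives the initial types ([true] is t^+), and [c v] is the coin that
   decides whether [v] changes its type in case of a tie. *)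
Definition fsp (t c : V -> bool) (v : V) : bool :=
  let same := #|[set u in neighbors v | t u == t v]%SET| in
  let diff := #|[set u in neighbors v | t u != t v]%SET| in
  if (degree v < 2 * same)%N then t v
  else if (degree v < 2 * diff)%N then ~~ t v
  else if c v then ~~ t v else t v.

Definition monochrome_edges (t : V -> bool) : {set {set V}} :=
  [set E in edges | [forall u in E, forall v in E, t u == t v]]%SET.

(* Since x / 0 = 0, this is 0 on the empty graph. *)
Definition monochrome_fraction (R : realType) (t : V -> bool) : R :=
  #|monochrome_edges t|%:R / #|edges|%:R.

End flip_schelling_process.

Section random_geometric_graph.
Context (R : realType).

(* [measurableTypeR R] is R with its Borel sigma-algebra. *)
Local Notation point := (measurableTypeR R * measurableTypeR R)%type.

Definition circle_dist (x y : R) : R := Num.min `|x - y| (1 - `|x - y|).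

Definition torus_dist (u v : point) : R :=
  Num.sqrt (circle_dist u.1 v.1 ^+ 2 + circle_dist u.2 v.2 ^+ 2).

Definition geometric_graph (n : nat) (r : R) (p : n.-tuple point) : rel 'I_n :=
  fun u v => (u != v) && (torus_dist (tnth p u) (tnth p v) <= r).

Definition expected_avg_degree (n : nat) (r : R) : R := (n%:R - 1) * pi * r ^+ 2.

Definition uniform_square : probability point R :=
  (uniform_prob (@ltr01 R) \x uniform_prob (@ltr01 R))%E.

Definition fair_coin : probability bool R := bernoulli_prob (2^-1 : R).

(* Outcomes are ((positions, initial types), coins). *)
Definition fsp_prob (n : nat) :
    probability (n.-tuple point * n.-tuple bool * n.-tuple bool)%type R :=
  (iid uniform_square n \x iid fair_coin n \x iid fair_coin n)%E.

Definition fsp_monochrome_fraction (n : nat) (r : R)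
    (w : n.-tuple point * n.-tuple bool * n.-tuple bool) : R :=
  let G := geometric_graph r w.1.1 in
  monochrome_fraction G R (fsp G (tnth w.1.2) (tnth w.2)).

End random_geometric_graph.

(* Main.v *)
Require Import Defs.
From mathcomp Require Import all_boot all_order all_algebra.
From mathcomp Require Import all_classical all_reals all_analysis.
From mathcomp Require Import measurable_realfun ring lra zify.
Import Order.TTheory GRing.Theory Num.Theory.
Import numFieldNormedType.Exports.
Local Open Scope classical_set_scope.
Local Open Scope ring_scope.

(* Condition on the graph.  After one step the type of u is the sign of the sum
   of the initial types (+1 or -1) of its neighbours, ties being broken by a fair
   coin, so an edge uv is monochrome with probability 1/2 + E[sgn S_u sgn S_v]/2.
   Averaging out the neighbours that are not shared turns sgn into odd functions
   g, h of the sum C over the k common neighbours, concave on the nonnegative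
   integers.  Hence g(c)/c and h(c)/c both decrease with |c|, and Chebyshev's
   association inequality with weight c^2 gives
     E[g(C) h(C)] >= E[C g(C)] E[C h(C)] / E[C^2] >= k / (3 sqrt(d_u d_v)),
   the last step by E|S_d| >= sqrt(d/3) (fourth moment method).

   So E[F] is at least the expectation of Y/|E|, where Y sums
   1/2 + k/(3(d_u + d_v)) over the edges.  As Y <= |E|, replacing |E| by its mean
   costs at most the relative deviation of |E|, which vanishes by Chebyshev's
   inequality, and 1/(d_u + d_v) is bounded below by a tangent, which leaves only
   probabilities of triangles and of triangles with a pendant edge.  Crude areas
   (a disc lies in a square of side 2r, a triangle has probability at least r^4)
   then give E[F] >= 1/2 + 9/3200 for all large n, uniformly in the expected
   degree, and the bound to be proved never exceeds 1/2 + 9/3200, even with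
   eps = 0. *)

(** * Sums of independent signs *)

Section smoothing.
Context {R : realType}.
Implicit Types (f g h : int -> R) (c d : int).

(* [iter m smooth h c] is the expectation of [h (c + S)], where [S] is a sum of [m]
   independent uniform signs. *)
Definition smooth h c : R := (h (c + 1) + h (c - 1)) / 2.

Lemma iter_smooth_le m f g : (forall c, f c <= g c) ->
  forall c, iter m smooth f c <= iter m smooth g c.
Proof.
move=> fg; elim: m => //= m IH c.
by rewrite /smooth; have := IH (c + 1); have := IH (c - 1); lra.
Qed.

Lemma iter_smooth_lin m a b f g c :
  iter m smooth (fun x => a * f x + b * g x) c =
  a * iter m smooth f c + b * iter m smooth g c.
Proof.
elim: m c => //= m IH c; rewrite /smooth !IH; ring.
Qed.

Lemma iter_smooth_sqr m c : iter m smooth (fun x => x%:~R ^+ 2) c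
  = c%:~R ^+ 2 + m%:R :> R.
Proof.
elim: m c => /= [|m IH] c; first by rewrite addr0.
rewrite /smooth !IH !rmorphD/= rmorphN/= -natr1 /=; by field.
Qed.

Lemma iter_smooth_pow4 m c : iter m smooth (fun x => x%:~R ^+ 4) c
  = c%:~R ^+ 4 + 6 * m%:R * c%:~R ^+ 2 + 3 * m%:R ^+ 2 - 2 * m%:R :> R.
Proof.
elim: m c => /= [|m IH] c; first by ring.
rewrite /smooth !IH !rmorphD/= rmorphN/= -natr1 /=; by field.
Qed.

(** This class contains the sign function and is preserved by [smooth], so it contains every sign
    averaged over independent steps. On the nonpositive integers oddness turns concavity into
    convexity. *)
Definition concave_odd h := (forall c, h (- c) = - h c) /\
  (forall c, 0 <= c -> h (c + 1) + h (c - 1) <= 2 * h c).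

(** For [c > 0] the second difference of [smooth h] at [c] is the mean of those of [h] at [c + 1]
    and [c - 1], neither of which is negative; at [0] oddness makes it vanish. *)
Lemma concave_odd_smooth h : concave_odd h -> concave_odd (smooth h).
Proof.
move=> [odd conc].
have so c : smooth h (- c) = - smooth h c.
  rewrite /smooth (_ : - c + 1 = - (c - 1)); last by lia.
  by rewrite (_ : - c - 1 = - (c + 1)) ?odd; [field|lia].
split=> // c; rewrite le_eqVlt => /predU1P[<-|c0].
  by rewrite add0r sub0r so; have := so 0; rewrite oppr0; lra.
have c1 := conc (c + 1) (ltW (ltr_wpDr ler01 c0)).
have c2 := conc (c - 1); rewrite subr_ge0 in c2; have {}c2 := c2 c0.
rewrite /smooth (_ : c - 1 + 1 = c + 1 - 1); last by lia.
by rewrite (_ : c - 1 + 1 = c + 1 - 1) in c2; [lra|lia].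
Qed.

Lemma concave_odd_iter_smooth m h :
  concave_odd h -> concave_odd (iter m smooth h).
Proof. by move=> ch; elim: m => //= m; exact: concave_odd_smooth. Qed.


Definition sgr c : R := (sgz c)%:~R.

Lemma sgr_gt0 c : 0 < c -> sgr c = 1. Proof. by rewrite /sgr => /gtr0_sgz->. Qed.
Lemma sgr_lt0 c : c < 0 -> sgr c = -1. Proof. by rewrite /sgr => /ltr0_sgz->. Qed.
Lemma sgr0 : sgr 0 = 0. Proof. by rewrite /sgr sgz0. Qed.

Lemma concave_odd_sgr : concave_odd sgr.
Proof.
split=> c; first by rewrite /sgr sgzN rmorphN.
have le1 x : sgr x <= 1.
  by case: (ltgtP x 0) => [/sgr_lt0->|/sgr_gt0->|->]; rewrite ?sgr0; lra.
rewrite le_eqVlt => /predU1P[<-|c0].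
  by rewrite sgr0 add0r sub0r sgr_gt0// sgr_lt0//; lra.
by rewrite (sgr_gt0 c)//; have := le1 (c + 1); have := le1 (c - 1); lra.
Qed.

(** Chords from the origin of a concave function vanishing at [0] have decreasing slopes.
    Consecutive slopes are compared first, with denominators cleared. *)
Lemma concave_odd_slope h (m n : nat) : concave_odd h -> (m <= n)%N ->
  m%:R * h n%:Z <= n%:R * h m%:Z.
Proof.
move=> [odd conc].
have h0 : h 0 = 0 by have := odd 0; rewrite oppr0; lra.
have step k : k%:R * h k.+1%:Z <= k.+1%:R * h k%:Z.
  elim: k => [|k IH]; first by rewrite h0; lra.
  have := conc k.+1%:Z isT.
  rewrite (_ : k.+1%:Z + 1 = k.+2%:Z); last by lia.
  rewrite (_ : k.+1%:Z - 1 = k%:Z); last by lia.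
  move/(ler_wpM2l (ler0n R k.+1)).
  by move: IH; rewrite -!natr1; lra.
case: m => [|m]; first by rewrite h0; lra.
elim: n => // n IH; rewrite leq_eqVlt => /predU1P[->//|mn].
have {}IH := IH mn.
have n0 : (0 : R) < n%:R by rewrite ltr0n; case: n mn {IH}.
rewrite -(ler_pM2l n0).
rewrite mulrCA; apply: le_trans (_ : m.+1%:R * (n.+1%:R * h n) <= _).
  by rewrite ler_pM2l ?ltr0n// step.
by rewrite mulrCA [leRHS]mulrCA ler_pM2l ?ltr0n.
Qed.

(* Two sequences [g c / c] and [h c / c] that decrease with [`|c|] are similarly
   ordered; multiplied out to avoid dividing by [c]. *)
Lemma concave_odd_association g h c d : concave_odd g -> concave_odd h ->
  0 <= (d%:~R * g c - c%:~R * g d) * (d%:~R * h c - c%:~R * h d).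
Proof.
move=> cg ch.
have nat_case (m n : nat) : 0 <= (n%:R * g m%:Z - m%:R * g n%:Z) * (n%:R *
    h m%:Z - m%:R * h n%:Z).
  case/orP: (leq_total m n) => mn.
    by apply: mulr_ge0; rewrite subr_ge0 concave_odd_slope.
  by apply: mulr_le0; rewrite subr_le0 concave_odd_slope.
(* Negating one argument, or exchanging the two, changes the sign of both factors and so preserves
   their product; this reduces all signs to the natural numbers. *)
have odd_case c' d' : 0 <= (d'%:~R * g c' - c'%:~R * g d') * (d'%:~R * h c' - c'%:~R *
    h d') ->
   0 <= (d'%:~R * g (- c') - (- c')%:~R * g d') * (d'%:~R * h (- c') - (- c')%:~R * h d').
  by rewrite cg.1 ch.1 rmorphN; congr (0 <= _); ring.
have swap c' d' : 0 <= (d'%:~R * g c' - c'%:~R * g d') * (d'%:~R * h c' - c'%:~R *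
    h d') ->
   0 <= (c'%:~R * g d' - d'%:~R * g c') * (c'%:~R * h d' - d'%:~R * h c').
  by congr (0 <= _); ring.
have natc n c' : 0 <= (n%:R * g c' - c'%:~R * g n%:Z) * (n%:R * h c' - c'%:~R * h n%:Z).
  by case: (intP c') => [|m|m]; [exact: (nat_case 0%N)|exact: nat_case|
    apply: (odd_case _ n%:Z); exact: nat_case].
case: (intP d) => [|m|m]; [exact: (natc 0%N)|exact: (natc m.+1)|].
by apply/swap/odd_case/swap; exact: (natc m.+1).
Qed.

(** Fourth moment method: [|x|] has a minorant [a x^2 - b x^4], whose mean is known from the moments
    [m] and [3 m^2 - 2 m]. The minorant touches [|x|] at [nu], where [nu^2 = 3 m] is about the ratio
    of the two moments. *)
Lemma iter_smooth_abs_ge m : (0 < m)%N ->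
  m%:R / Num.sqrt (3 * m%:R) <= iter m smooth (fun x => `|x%:~R|) 0 :> R.
Proof.
move=> m0; set nu := Num.sqrt _.
have m0' : (0 : R) < m%:R by rewrite ltr0n.
have nu0 : 0 < nu by rewrite sqrtr_gt0 mulr_gt0.
have nu2 : nu ^+ 2 = 3 * m%:R by rewrite sqr_sqrtr// mulr_ge0.
(* tangency at [`|x| = nu]: [y ^ 3 - 3 nu ^ 2 y + 2 nu ^ 3 = (y - nu) ^ 2 (y + 2 nu)] *)
have le x : (3 * nu ^+ 2) / (2 * nu ^+ 3) * x%:~R ^+ 2 + - (2 * nu ^+ 3)^-1 *
    x%:~R ^+ 4 <= `|x%:~R| :> R.
  rewrite -(ler_pM2l (_ : 0 < 2 * nu ^+ 3)); last by rewrite mulr_gt0// exprn_gt0.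
  rewrite (_ : _ * (_ + _) = 3 * nu ^+ 2 * x%:~R ^+ 2 - x%:~R ^+ 4); last by field;
      rewrite gt_eqF.
  have y0 : 0 <= `|x%:~R| :> R by [].
  rewrite -(real_normK (num_real (x%:~R))) (_ : 4%N =
      (2 * 2)%N)// exprM -(real_normK (num_real (x%:~R))).
  set y := `|_| in y0 *; rewrite -subr_ge0.
  rewrite (_ : _ - _ = y * ((y - nu) ^+ 2 * (y + 2 * nu))); last by ring.
  by rewrite mulr_ge0// mulr_ge0 ?sqr_ge0// addr_ge0// mulr_ge0// ltW.
apply: le_trans (iter_smooth_le m _ _ le 0).
rewrite iter_smooth_lin iter_smooth_sqr iter_smooth_pow4.
rewrite !expr0n/= add0r mulr0 !add0r -subr_ge0.
(* The surplus comes from the term [- 2 m] of the fourth moment. *)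
rewrite (_ : _ - _ = m%:R / nu ^+ 3); first by rewrite divr_ge0// exprn_ge0// ltW.
suff -> : m%:R = nu ^+ 2 / 3 by field; rewrite gt_eqF.
by rewrite nu2; field.
Qed.

End smoothing.

(** * Correlation of the majorities of two overlapping sets *)

Section spins.
Context {R : realType} {V : finType}.
Local Notation types := {ffun V -> bool}.
Implicit Types (t : types) (A N : {set V}) (w : V) (h : int -> R).

Definition spin (b : bool) : int := if b then 1 else -1.

Definition net A t : int := \sum_(w in A) spin (t w).

Definition flip w t : types :=
  [ffun x => if x == w then ~~ t x else t x].

Lemma flipK w : involutive (flip w).
Proof. by move=> t; apply/ffunP => x; rewrite !ffunE; case: eqP => // _;
    rewrite negbK. Qed.

Lemma spin_flip w t : spin (flip w t w) = - spin (t w).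
Proof. by rewrite ffunE eqxx; case: (t w); rewrite /spin ?opprK. Qed.

Lemma net_flip w A t : w \notin A -> net A (flip w t) = net A t.
Proof.
move=> wA; apply: eq_bigr => x xA; rewrite ffunE; case: eqP => // xw.
by rewrite -xw xA in wA.
Qed.

(** Reindexing along [flip w] fixes [G] and [Y] and negates [spin (t w)], so the sum equals its mean
    over both signs. *)
Lemma sum_smooth1 w (G : types -> R) (Y : types -> int) h :
  (forall t, G (flip w t) = G t) -> (forall t, Y (flip w t) = Y t) ->
  \sum_t G t * h (Y t + spin (t w)) = \sum_t G t * smooth h (Y t).
Proof.
move=> Gw Yw.
have E : \sum_t G t * h (Y t + spin (t w)) = \sum_t G t * h (Y t - spin (t w)).
  rewrite (reindex_inj (inv_inj (flipK w))).
  by apply: eq_bigr => t _; rewrite Gw Yw spin_flip.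
transitivity (2^-1 * (\sum_t G t * h (Y t + spin (t w)) +
                      \sum_t G t * h (Y t - spin (t w)))).
  by rewrite -E; field.
rewrite -big_split mulr_sumr; apply: eq_bigr => t _.
rewrite /smooth /spin; case: (t w) => /=; rewrite ?opprK; by field.
Qed.

(** Averages out the types on [A], one vertex at a time. Invariance under flips inside [A] is the
    finite form of independence from these types. *)
Lemma sum_smooth A (G : types -> R) (Y : types -> int) h :
  (forall w t, w \in A -> G (flip w t) = G t) ->
  (forall w t, w \in A -> Y (flip w t) = Y t) ->
  \sum_t G t * h (Y t + net A t) = \sum_t G t * iter #|A| smooth h (Y t).
Proof.
move: {2}#|A| (erefl #|A|) => m; elim: m A Y => [|m IH] A Y cA GA YA.
  rewrite cA; apply: eq_bigr => t _.
  by rewrite (cards0_eq cA) /net big_set0 addr0.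
have [w wA] : exists w, w \in A by apply/card_gt0P; rewrite cA.
have cA' : #|A :\ w| = m by have := cardsD1 w A; rewrite wA cA => -[].
transitivity (\sum_t G t * h ((Y t + spin (t w)) + net (A :\ w) t)).
  by apply: eq_bigr => t _; rewrite /net (big_setD1 w)//= addrA.
rewrite (IH _ (fun t => Y t + spin (t w)))//; last 2 first.
- by move=> x t /setD1P[_ /GA].
- by move=> x t /setD1P[xw /YA->]; rewrite ffunE eq_sym (negbTE xw).
rewrite cA' (sum_smooth1 w G Y (iter m smooth h)) ?cA//= => t; [exact: GA|exact: YA].
Qed.

Lemma sum_net A h : \sum_(t : types) h (net A t) = #|types|%:R * iter #|A| smooth h 0.
Proof.
transitivity (\sum_(t : types) 1 * h (0 + net A t)).
  by apply: eq_bigr => t _; rewrite mul1r add0r.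
rewrite (sum_smooth A (fun=> 1) (fun=> 0) h)//.
by rewrite sumr_const -[LHS]mulr_natl mul1r.
Qed.

(* The correlation of one of [m] signs with the sign of their sum. *)
Definition influence (m : nat) : R := iter m.-1 smooth sgr 1.

Lemma sum_spin_sgr N w : w \in N ->
  \sum_(t : types) (spin (t w))%:~R * sgr (net N t) = #|types|%:R * influence #|N| :> R.
Proof.
move=> wN; have cN := cardsD1 w N; rewrite wN in cN.
transitivity (\sum_(t : types) (spin (t w))%:~R * sgr (spin (t w) + net (N :\ w) t) : R).
  by apply: eq_bigr => t _; rewrite /net (big_setD1 w).
have fl x t : x \in N :\ w -> spin (flip x t w) = spin (t w).
  by move=> /setD1P[xw _]; rewrite ffunE eq_sym (negbTE xw).
rewrite (sum_smooth _ (fun t => (spin (t w))%:~R) (fun t => spin (t w))); last 2 first.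
- by move=> x t /fl->.
- by move=> x t /fl->.
rewrite (eq_bigr (fun=> influence #|N|)).
  by rewrite sumr_const -[LHS]mulr_natl.
(* Oddness gives minus the value at [1] when [w] has spin [-1], and the factor [spin (t w)] cancels
   that sign. *)
move=> t _; rewrite /influence cN add1n /=.
have [odd _] := concave_odd_iter_smooth #|N :\ w| _ (@concave_odd_sgr R).
by case: (t w); rewrite /spin ?odd ?rmorphN/=; ring.
Qed.

(** Linearity over the members of [A]. For [A = N] this is the mean of [|S_N|]; for [A] the common
    neighbours it gives the two factors in the association inequality. *)
Lemma sum_net_sgr A N : A \subset N ->
  \sum_(t : types) (net A t)%:~R * sgr (net N t) =
  #|A|%:R * (#|types|%:R * influence #|N|) :> R.
Proof.
move=> AN; under eq_bigr do rewrite /net rmorph_sum mulr_suml.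
rewrite exchange_big/= mulr_natl -sumr_const.
apply: eq_bigr => w wA; by rewrite sum_spin_sgr// (fintype.subsetP AN).
Qed.

Lemma card_ffun_gt0 : (0 : R) < #|types|%:R.
Proof. by rewrite ltr0n; apply/card_gt0P; exists [ffun=> true]. Qed.

Lemma influence_ge N : (0 < #|N|)%N ->
  (Num.sqrt (3 * #|N|%:R))^-1 <= influence #|N|.
Proof.
move=> N0; have N0' : (0 : R) < #|N|%:R by rewrite ltr0n.
have := iter_smooth_abs_ge #|N| N0 => /(_ R).
rewrite -(ler_pM2l card_ffun_gt0) -sum_net.
under eq_bigr => t _.
  rewrite (_ : `|_| = (net N t)%:~R * sgr (net N t)); last first.
    by rewrite /sgr -rmorphM /= -intr_norm mulrC -normrEsg.
  over.
by rewrite sum_net_sgr// mulrCA !(ler_pM2l N0', ler_pM2l card_ffun_gt0).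
Qed.

(** Each sum splits into a common and a private part; the private parts live on disjoint sets and
    are averaged out one after the other. *)
Lemma sum_sgr_overlap N1 N2 :
  \sum_(t : types) sgr (net N1 t) * sgr (net N2 t) =
  \sum_(t : types) iter #|N1 :\: N2| smooth sgr (net (N1 :&: N2) t) *
         iter #|N2 :\: N1| smooth sgr (net (N1 :&: N2) t) :> R.
Proof.
have split1 t : net N1 t = net (N1 :&: N2) t + net (N1 :\: N2) t.
  by rewrite /net [LHS](big_setID N2).
have split2 t : net N2 t = net (N1 :&: N2) t + net (N2 :\: N1) t.
  by rewrite /net [LHS](big_setID N1)/= finset.setIC.
pose g : int -> R := iter #|N1 :\: N2| smooth sgr.
transitivity (\sum_(t : types) sgr (net N2 t) * sgr (net (N1 :&: N2) t +
    net (N1 :\: N2) t) : R).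
  by apply: eq_bigr => t _; rewrite split1 mulrC.
rewrite (sum_smooth _ (fun t => sgr (net N2 t)) (net (N1 :&: N2))); last 2 first.
- by move=> w t /finset.setDP[_ wN]; rewrite net_flip.
- by move=> w t /finset.setDP[_ wN]; rewrite net_flip// inE (negbTE wN) andbF.
transitivity (\sum_(t : types) g (net (N1 :&: N2) t) * sgr (net (N1 :&: N2) t +
    net (N2 :\: N1) t) : R).
  by apply: eq_bigr => t _; rewrite split2 mulrC.
rewrite (sum_smooth _ (fun t => g (net (N1 :&: N2) t)) (net (N1 :&: N2)))//.
- by move=> w t /finset.setDP[_ wN]; rewrite net_flip// inE (negbTE wN).
- by move=> w t /finset.setDP[_ wN]; rewrite net_flip// inE (negbTE wN).
Qed.

(** The geometric mean of the two sizes is weakened to the arithmetic one, so that later only the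
    sum of two degrees appears in a denominator. *)
Lemma sum_sgr_overlap_ge N1 N2 :
  #|types|%:R * (2 * #|N1 :&: N2|%:R / (3 * (#|N1| + #|N2|)%:R)) <=
  \sum_(t : types) sgr (net N1 t) * sgr (net N2 t) :> R.
Proof.
set Z : R := #|types|%:R; have Z0 : 0 < Z := card_ffun_gt0.
set C := N1 :&: N2.
have cg m := concave_odd_iter_smooth m _ (@concave_odd_sgr R).
have moment N : C \subset N ->
    \sum_(t : types) (net C t)%:~R * iter #|N :\: C| smooth sgr (net C t) =
    #|C|%:R * (Z * influence #|N|) :> R.
  move=> CN; rewrite -sum_net_sgr//.
  rewrite -(sum_smooth _ (fun t => (net C t)%:~R) (net C)); last 2 first.
  - by move=> w t /finset.setDP[_ wN]; rewrite net_flip.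
  - by move=> w t /finset.setDP[_ wN]; rewrite net_flip.
  apply: eq_bigr => t _; congr (_ * sgr _).
  by rewrite /net [RHS](big_setID C)/= (finset.setIidPr CN).
(* Without common members both averaged signs are odd functions taken at [0], hence zero; otherwise
   [#|C|] can be divided out. *)
have [C0|C0] := posnP #|C|.
  rewrite C0 mulr0 mul0r mulr0 sum_sgr_overlap -/C (cards0_eq C0).
  apply: sumr_ge0 => t _.
  rewrite /net big_set0.
  by have := cg #|N1 :\: N2| => -[+ _]; have := cg #|N2 :\: N1| => -[+ _];
      move=> /(_ 0) + /(_ 0); rewrite oppr0 => h1 h2; nra.
have C0' : (0 : R) < #|C|%:R by rewrite ltr0n.
have CN1 : C \subset N1 := finset.subsetIl _ _.
have CN2 : C \subset N2 := finset.subsetIr _ _.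
have := moment _ CN1; have := moment _ CN2.
have -> : N1 :\: C = N1 :\: N2 by rewrite finset.setDIr finset.setDv finset.set0U.
have -> : N2 :\: C = N2 :\: N1 by rewrite finset.setDIr finset.setDv finset.setU0.
rewrite sum_sgr_overlap -/C.
set g := iter #|N1 :\: N2| smooth sgr; set h := iter #|N2 :\: N1| smooth sgr.
move=> mh mg.
have m2 : \sum_(t : types) (net C t)%:~R ^+ 2 = Z * #|C|%:R :> R.
  by rewrite (sum_net C (fun x => x%:~R ^+ 2)) iter_smooth_sqr expr0n add0r.
have assoc : (\sum_(t : types) (net C t)%:~R * g (net C t)) *
    (\sum_(t : types) (net C t)%:~R * h (net C t)) <=
     (\sum_(t : types) (net C t)%:~R ^+ 2) * \sum_(t : types) g (net C t) *
         h (net C t) :> R.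
  (* Chebyshev's trick with an independent copy [s] of [t]: expanding this double sum gives twice
     the difference of the two sides. *)
  have pair : 0 <= \sum_(t : types) \sum_s
      ((net C s)%:~R * g (net C t) - (net C t)%:~R * g (net C s)) *
      ((net C s)%:~R * h (net C t) - (net C t)%:~R * h (net C s)).
    by apply: sumr_ge0 => t _; apply: sumr_ge0 => s _; apply: concave_odd_association;
        exact: cg.
  rewrite -subr_ge0.
  rewrite (_ : _ - _ = 2^-1 * \sum_(t : types) \sum_s
      ((net C s)%:~R * g (net C t) - (net C t)%:~R * g (net C s)) *
      ((net C s)%:~R * h (net C t) - (net C t)%:~R * h (net C s)));
          first by apply: mulr_ge0 => //; rewrite invr_ge0.
  have prod2 (a b : types -> R) : (\sum_(t : types) a t) * (\sum_(t : types) b t) =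
      \sum_(t : types) \sum_(s : types) a t * b s.
    by rewrite mulr_suml; apply: eq_bigr => t _; rewrite mulr_sumr.
  rewrite !prod2.
  transitivity (2^-1 * (\sum_(t : types) \sum_(s : types) (net C t)%:~R ^+ 2 *
      (g (net C s) * h (net C s)) +
      \sum_(s : types) \sum_(t : types) (net C t)%:~R ^+ 2 * (g (net C s) * h (net C s)) -
      (\sum_(t : types) \sum_(s : types) (net C t)%:~R * g (net C t) * ((net C s)%:~R *
          h (net C s)) +
       \sum_(s : types) \sum_(t : types) (net C t)%:~R * g (net C t) * ((net C s)%:~R *
           h (net C s))))).
    rewrite [X in _ = 2^-1 * (_ + X - _)]exchange_big/=.
    by rewrite [X in _ = 2^-1 * (_ - (_ + X))]exchange_big/=; field.
  rewrite -!big_split -sumrB/=; congr (_ * _); apply: eq_bigr => t _.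
  rewrite -!big_split -sumrB/=; apply: eq_bigr => s _; ring.
move: assoc; rewrite mh mg m2.
have c1 : (0 < #|N1|)%N := leq_trans C0 (subset_leq_card CN1).
have c2 : (0 < #|N2|)%N := leq_trans C0 (subset_leq_card CN2).
have := influence_ge N1 c1; have := influence_ge N2 c2.
set a1 := influence #|N1|; set a2 := influence #|N2|.
set s1 := Num.sqrt (3 * #|N1|%:R); set s2 := Num.sqrt (3 * #|N2|%:R).
have s10 : 0 < s1 by rewrite sqrtr_gt0 mulr_gt0// ltr0n.
have s20 : 0 < s2 by rewrite sqrtr_gt0 mulr_gt0// ltr0n.
have s1E : s1 ^+ 2 = 3 * #|N1|%:R by rewrite sqr_sqrtr// mulr_ge0.
have s2E : s2 ^+ 2 = 3 * #|N2|%:R by rewrite sqr_sqrtr// mulr_ge0.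
move=> le2 le1 assoc.
(* The inequality [2 s1 s2 <= s1^2 + s2^2], combined with the two influence bounds. *)
have a12 : 2 / (s1 ^+ 2 + s2 ^+ 2) <= a1 * a2.
  apply: (@le_trans _ _ (s1^-1 * s2^-1)); last by rewrite ler_pM// invr_ge0 ltW.
  rewrite ler_pdivrMr; last by rewrite addr_gt0// exprn_gt0.
  rewrite -invfM -ler_pdivrMl ?invr_gt0 ?mulr_gt0// invrK.
  by rewrite -subr_ge0 (_ : _ - _ = (s1 - s2) ^+ 2) ?sqr_ge0//; ring.
rewrite natrD mulrDr -s1E -s2E.
apply: le_trans (_ : Z * (#|C|%:R * (a1 * a2)) <= _).
  rewrite ler_pM2l// (_ : 2 * _ / _ = #|C|%:R * (2 / (s1 ^+ 2 + s2 ^+ 2))).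
    by rewrite ler_pM2l.
  by rewrite mulrCA !mulrA.
rewrite -(ler_pM2l (mulr_gt0 Z0 C0')); apply: le_trans assoc.
by rewrite [leLHS](_ : _ = #|C|%:R * (Z * a1) * (#|C|%:R * (Z * a2))); last by ring.
Qed.

End spins.

(** * One step of the process on a fixed graph *)

Section flip_schelling_average.
Context {R : realType} {V : finType} (e : rel V).
Local Notation types := {ffun V -> bool}.
Implicit Types (t c : types) (u v : V).

Lemma net_neighbors t v :
  net (neighbors e v) t = spin (t v) *
    (#|[set u in neighbors e v | t u == t v]%SET|%:Z -
     #|[set u in neighbors e v | t u != t v]%SET|%:Z).
Proof.
rewrite /net (bigID (fun w => t w == t v))/= mulrBr; congr (_ + _).
  rewrite (eq_bigl [in [set u in neighbors e v | t u == t v]%SET]); last by move=> w;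
      rewrite !inE.
  rewrite (eq_bigr (fun=> spin (t v))); first by rewrite sumr_const -mulr_natr natz.
  by move=> w; rewrite inE => /andP[_ /eqP->].
rewrite (eq_bigl [in [set u in neighbors e v | t u != t v]%SET]); last by move=> w;
    rewrite !inE.
rewrite (eq_bigr (fun=> - spin (t v))); first by rewrite sumr_const -mulr_natr natz mulNr.
by move=> w; rewrite inE => /andP[_]; rewrite /spin; case: (t w); case: (t v).
Qed.

(** Keeping one's type with a majority of equals and changing it with a majority of opposites both
    mean adopting the majority type of the neighbours; the own type matters only in a tie. *)
Lemma fspE t c v : fsp e t c v =
  if 0 < net (neighbors e v) t then true
  else if net (neighbors e v) t < 0 then false else t v (+) c v.
Proof.
rewrite net_neighbors /fsp.
set same := #|_|; set diff := #|[set u in _ | _ != _]%SET|.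
have -> : degree e v = (same + diff)%N.
  rewrite /degree -(cardsID [set u | t u == t v]%SET); congr (_ + _)%N.
    by apply: eq_card => u; rewrite !inE.
  by apply: eq_card => u; rewrite !inE andbC.
clearbody same diff.
have -> : (same + diff < 2 * same)%N = (diff < same)%N by apply/idP/idP; lia.
have -> : (same + diff < 2 * diff)%N = (same < diff)%N by apply/idP/idP; lia.
rewrite /spin; case: (t v); rewrite ?mul1r ?mulN1r ?oppr_gt0 ?oppr_lt0 subr_gt0
    subr_lt0 !ltz_nat.
  by case: ltngtP => //; case: (c v).
by case: ltngtP => //; case: (c v).
Qed.

(* The coins enter through [x], a sign, so that averaging over a coin is [smooth]. *)
Definition coin_spin t v (x : int) : R :=
  if net (neighbors e v) t == 0 then - (spin (t v) * x)%:~R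
  else sgr (net (neighbors e v) t).

Lemma spin_fsp t c v : (spin (fsp e t c v))%:~R = coin_spin t v (spin (c v)).
Proof.
rewrite fspE /coin_spin; case: (ltgtP (net _ _) 0) => [n0|n0|_].
- by rewrite sgr_lt0.
- by rewrite sgr_gt0.
by rewrite /spin; case: (t v); case: (c v) => /=; rewrite -rmorphN/=.
Qed.

Lemma smooth_coin_spin t v : smooth (coin_spin t v) 0 = sgr (net (neighbors e v) t).
Proof.
rewrite /smooth /coin_spin; case: eqP => [->|_]; last by field.
by rewrite sgr0 !rmorphM/=; field.
Qed.

(** Distinct vertices have independent coins, so the coins are averaged separately; in a tie the
    mean is [0], the value of [sgr] there. *)
Lemma sum_coins t u v : u != v ->
  \sum_(c : types) (spin (fsp e t c u))%:~R * (spin (fsp e t c v))%:~R =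
  #|types|%:R *
    (sgr (net (neighbors e u) t) * sgr (net (neighbors e v) t)) :> R.
Proof.
move=> uv.
transitivity (\sum_(c : types) coin_spin t v (spin (c v)) * coin_spin t u (0 +
    spin (c u))).
  by apply: eq_bigr => c _; rewrite !spin_fsp add0r mulrC.
rewrite (sum_smooth1 u (fun c => coin_spin t v (spin (c v))) (fun=> 0))//; last first.
  by move=> c; rewrite ffunE eq_sym (negbTE uv).
transitivity (\sum_(c : types) smooth (coin_spin t u) 0 * coin_spin t v (0 + spin (c v))).
  by apply: eq_bigr => c _; rewrite add0r mulrC.
rewrite (sum_smooth1 v (fun=> smooth (coin_spin t u) 0) (fun=> 0))//.
by rewrite !smooth_coin_spin sumr_const -[LHS]mulr_natl.
Qed.

Lemma sum_agree_ge u v : u != v ->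
  #|types|%:R ^+ 2 *
    (2^-1 + #|neighbors e u :&: neighbors e v|%:R / (3 * (degree e u + degree e v)%:R)) <=
  \sum_(t : types) \sum_(c : types)
    (fsp e t c u == fsp e t c v)%:R :> R.
Proof.
move=> uv; set Z : R := #|types|%:R.
have agree a b : (a == b)%:R = (1 + (spin a)%:~R * (spin b)%:~R) / 2 :> R.
  by case: a; case: b; rewrite /spin ?rmorphN/=; field.
under eq_bigr => t _.
  under eq_bigr do rewrite agree mulrDl mul1r.
  rewrite big_split/= sumr_const -mulr_suml sum_coins// -[X in X + _]mulr_natl.
  over.
rewrite big_split/= sumr_const -mulr_suml -mulr_sumr -[X in _ <= X + _]mulr_natl.
set S := (X in _ * X / 2).
rewrite [leRHS](_ : _ = Z ^+ 2 * 2^-1 + Z * (S / 2)); last by rewrite expr2 !mulrA.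
rewrite mulrDr lerD2l expr2 -mulrA ler_pM2l ?card_ffun_gt0// ler_pdivlMr//.
apply: le_trans (@sum_sgr_overlap_ge R V (neighbors e u) (neighbors e v)).
rewrite -/Z -/(degree e u) -/(degree e v).
by set d := _^-1; rewrite [leLHS](_ : _ =
    Z * (2 * #|neighbors e u :&: neighbors e v|%:R * d))//; ring.
Qed.

Hypothesis (e_sym : symmetric e) (e_irr : irreflexive e).

(** An edge is the image of exactly two ordered pairs: symmetry supplies both, and the absence of
    loops makes them different. *)
Lemma card_edges (P : pred {set V}) :
  (\sum_u \sum_v (e u v && P [set u; v]%SET) = 2 * #|[set E in edges e | P E]%SET|)%N.
Proof.
pose D := [set uv : V * V | e uv.1 uv.2 && P [set uv.1; uv.2]%SET]%SET.
have -> : (\sum_u \sum_v (e u v && P [set u; v]%SET))%N = #|D|.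
  rewrite pair_big/= -sum1_card [RHS]big_mkcond/=.
  by apply: eq_bigr => uv _; rewrite inE; case: (_ && _).
have -> : [set E in edges e | P E]%SET = [set [set uv.1; uv.2]%SET | uv in D]%SET.
  apply/setP => E; rewrite inE; apply/andP/imsetP => [[/imsetP[uv]]|[uv]].
    by rewrite inE => euv -> PE; exists uv => //; rewrite inE euv.
  by rewrite inE => /andP[euv PE] ->; split => //; apply/imsetP; exists uv; rewrite ?inE.
rewrite -sum1_card (partition_big_imset (fun uv : V * V => [set uv.1; uv.2]%SET))/=.
rewrite mulnC -sum_nat_const; apply: eq_bigr => E /imsetP[[u v]].
rewrite inE/= => /andP[euv PE] ->.
have uv : u != v by apply: contraL euv => /eqP->; rewrite e_irr.
transitivity #|[set (u, v); (v, u)]%SET|; last by rewrite cards2 xpair_eqE negb_and uv.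
rewrite -sum1_card; apply: eq_bigl => -[x y]; rewrite !inE/= !xpair_eqE.
apply/andP/orP => [[_ /eqP exy]|[]/andP[/eqP-> /eqP->]].
- have : x \in [set u; v]%SET by rewrite -exy !inE eqxx.
  have : y \in [set u; v]%SET by rewrite -exy !inE eqxx orbT.
  have : u \in [set x; y]%SET by rewrite exy !inE eqxx.
  have : v \in [set x; y]%SET by rewrite exy !inE eqxx orbT.
  rewrite !inE => /orP[]/eqP vE /orP[]/eqP uE; subst; rewrite ?eqxx in uv * => //.
    by right.
  by left.
- by rewrite euv PE eqxx.
- by rewrite e_sym euv finset.setUC PE eqxx.
Qed.

(** Ordered pairs double numerator and denominator alike. The sums over pairs are linear in the
    indicators, which suits expectations; without edges both sides are [0]. *)
Lemma monochrome_fractionE (s : V -> bool) : monochrome_fraction e R s =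
  (\sum_u \sum_v (e u v && (s u == s v))%:R) / (\sum_u \sum_v (e u v)%:R).
Proof.
have natsum (f : V -> V -> bool) :
    \sum_u \sum_v (f u v)%:R = (\sum_u \sum_v f u v)%N%:R :> R.
  by rewrite natr_sum; apply: eq_bigr => u _; rewrite natr_sum.
rewrite /monochrome_fraction !natsum.
have -> : (\sum_u \sum_v e u v = 2 * #|edges e|)%N.
  rewrite -[edges e]finset.setIT -[RHS](_ : 2 * #|[set E in edges e | xpredT E]%SET| =
      _)%N.
    by rewrite -card_edges; apply: eq_bigr => u _; apply: eq_bigr => v _; rewrite andbT.
  by congr (_ * _)%N; apply: eq_card => E; rewrite !inE.
have -> : (\sum_u \sum_v (e u v && (s u == s v)) = 2 * #|monochrome_edges e s|)%N.
  rewrite -card_edges; apply: eq_bigr => u _; apply: eq_bigr => v _.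
  congr (nat_of_bool (_ && _)); apply/idP/forall_inP => [/eqP suv x xuv|/(_ u)].
    apply/forall_inP => y; move: xuv; rewrite !inE.
    by move=> /orP[]/eqP-> /orP[]/eqP->; rewrite ?suv.
  rewrite !inE eqxx => /(_ isT)/forall_inP/(_ v); rewrite !inE eqxx orbT; exact.
rewrite !natrM invfM mulrACA divff ?mul1r//.
Qed.

(** A lower bound for the mean fraction on a fixed graph: every edge is replaced by the bound on its
    probability of being monochrome. *)
Definition overlap_fraction : R :=
  (\sum_u \sum_v (e u v)%:R *
     (2^-1 + #|neighbors e u :&: neighbors e v|%:R /
             (3 * (degree e u + degree e v)%:R))) /
  (\sum_u \sum_v (e u v)%:R).

Lemma sum_monochrome_fraction_ge :
  #|types|%:R ^+ 2 * overlap_fraction <=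
  \sum_(t : types) \sum_(c : types)
    monochrome_fraction e R (fsp e t c) :> R.
Proof.
rewrite /overlap_fraction.
under [leRHS]eq_bigr do under eq_bigr do rewrite monochrome_fractionE.
under [leRHS]eq_bigr do rewrite -mulr_suml.
rewrite -mulr_suml mulrA ler_wpM2r//.
  by rewrite invr_ge0 sumr_ge0// => u _; rewrite sumr_ge0.
under [leRHS]eq_bigr do rewrite exchange_big/=.
rewrite [leRHS]exchange_big/= mulr_sumr ler_sum// => u _.
under [leRHS]eq_bigr do rewrite exchange_big/=.
rewrite [leRHS]exchange_big/= mulr_sumr ler_sum// => v _.
have [euv|euv] := boolP (e u v); last first.
  by rewrite mul0r mulr0 sumr_ge0// => t _; rewrite sumr_ge0.
rewrite mul1r/=; apply: sum_agree_ge.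
by apply: contraL euv => /eqP->; rewrite e_irr.
Qed.

End flip_schelling_average.

Arguments overlap_fraction R {V} e.

(** * Random graphs with weakly dependent edges *)

Section random_graph.
Context {R : realType} {V Gamma : finType} (wt : Gamma -> R) (e : Gamma -> rel V).
Hypotheses (wt_ge0 : forall G, 0 <= wt G) (wt1 : \sum_G wt G = 1).
Hypotheses (e_sym : forall G, symmetric (e G)) (e_irr : forall G, irreflexive (e G)).

Local Notation Ex f := (\sum_G wt G * f G).

Definition tri G (u v w : V) : R := (e G u v && e G u w && e G v w)%:R.

(** [p] is the edge probability, [P] bounds the conditional probability of a further edge to a new
    vertex, [tau] is a lower bound for the probability of a triangle, and [eta] is the free weight
    used in bounding the deviation of the number of edges. *)
Context (p P tau eta : R).
Hypotheses (p_gt0 : 0 < p) (P_ge0 : 0 <= P) (eta_gt0 : 0 < eta).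
Hypothesis V_gt1 : (1 < #|V|)%N.
Hypothesis edge_prob : forall u v, u != v -> Ex (fun G => (e G u v)%:R) = p.
Hypothesis edge_indep : forall u v x y, u != v -> x != y -> x != u -> x != v ->
  y != u -> y != v -> Ex (fun G => (e G u v && e G x y)%:R) <= p ^+ 2.
Hypothesis edge_adj : forall u v z, u != v -> u != z -> v != z ->
  Ex (fun G => (e G u v && e G u z)%:R) <= p * P.
Hypothesis tri_prob : forall u v w, u != v -> u != w -> v != w ->
  tau <= Ex (fun G => tri G u v w).
Hypothesis tri_edge : forall u v w z, u != v -> u != w -> v != w ->
  z != u -> z != v -> z != w ->
  Ex (fun G => tri G u v w * (e G u z)%:R) <= P * Ex (fun G => tri G u v w).

Let Ex_le (f g : Gamma -> R) : (forall G, f G <= g G) -> Ex f <= Ex g.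
Proof. by move=> fg; apply: ler_sum => G _; exact: ler_wpM2l. Qed.

Let n : R := #|V|%:R.
Let M G : R := \sum_u \sum_v (e G u v)%:R.
Let m : R := n * (n - 1) * p.
(** An upper bound for the conditional mean of [degs G u v], given that [u] and [v] lie in a given
    triangle; the tangent to [1 / d] is taken here. *)
Let t : R := 4 + 2 * n * P.
Let common G u v : R := #|neighbors (e G) u :&: neighbors (e G) v|%:R.
Let degs G u v : R := (degree (e G) u + degree (e G) v)%:R.
Let Y G : R := \sum_u \sum_v (e G u v)%:R * (2^-1 + common G u v / (3 * degs G u v)).

Let n_gt1 : 1 < n. Proof. by rewrite /n ltr1n. Qed.
Let n_gt0 : 0 < n. Proof. exact: lt_trans ltr01 n_gt1. Qed.
Let n1_gt0 : 0 < n - 1. Proof. by rewrite subr_gt0. Qed.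

Let sum_neq (x : V) : \sum_y (x != y)%:R = n - 1 :> R.
Proof.
rewrite -natr_sum -big_mkcond/= sum1_card.
have := cardC1 x => E; rewrite (@eq_card _ _ (predC1 x)).
  by rewrite E -subn1 natrB// ltnW.
by move=> y; rewrite !inE eq_sym.
Qed.

Let sum_eq (x : V) : \sum_y (y == x)%:R = 1 :> R.
Proof. by rewrite -natr_sum -big_mkcond/= (big_pred1 x). Qed.

Let sumc (c : R) : \sum_(x : V) c = n * c.
Proof. by rewrite sumr_const mulr_natl. Qed.

Let m_gt0 : 0 < m.
Proof. by rewrite !mulr_gt0. Qed.

Let t_gt0 : 0 < t.
Proof. by rewrite ltr_pwDl// !mulr_ge0// ltW. Qed.

Let edge_prob' u v : Ex (fun G => (e G u v)%:R) = (u != v)%:R * p.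
Proof.
have [<-|uv] := eqVneq u v; last by rewrite edge_prob ?mul1r.
by rewrite mul0r big1// => G _; rewrite e_irr mulr0.
Qed.

Let Ex_sum (F : V -> V -> Gamma -> R) :
  Ex (fun G => \sum_u \sum_v F u v G) = \sum_u \sum_v Ex (fun G => F u v G).
Proof.
under eq_bigr do rewrite mulr_sumr.
rewrite exchange_big/=; apply: eq_bigr => u _.
by under eq_bigr do rewrite mulr_sumr; rewrite exchange_big.
Qed.

Let Ex_M : Ex M = m.
Proof.
rewrite Ex_sum; under eq_bigr do under eq_bigr do rewrite edge_prob'.
under eq_bigr do rewrite -mulr_suml sum_neq.
by rewrite sumr_const -mulr_natl mulrA.
Qed.

(** Disjoint pairs, pairs sharing one vertex and equal pairs cost [p^2], [p * P] and [p]. A single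
    formula in indicators lets the sum over all quadruples be computed by linearity. *)
Let edge_pair u v x y : u != v -> x != y ->
  Ex (fun G => (e G u v && e G x y)%:R) <=
  (x != y)%:R * p ^+ 2 + ((x == u)%:R + (x == v)%:R + (y == u)%:R + (y == v)%:R) * (p * P)
   + ((x == u)%:R * (y == v)%:R + (x == v)%:R * (y == u)%:R) * p.
Proof.
move=> uv xy; rewrite xy mul1r.
have le1 : Ex (fun G => (e G u v && e G x y)%:R) <= p.
  by rewrite -(edge_prob _ _ uv); apply: Ex_le => G; case: (e G u v); case: (e G x y).
have p2 : 0 <= p ^+ 2 by rewrite sqr_ge0.
have pP : 0 <= p * P by rewrite mulr_ge0// ltW.
have [xu|xu] := eqVneq x u.
  have yu : y != u by rewrite -xu eq_sym.
  rewrite (negbTE yu); have [yv|yv] := eqVneq y v.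
    by move: le1; case: (x == v); rewrite /= !(mul1r,mul0r,mulr0,addr0,add0r) => h; lra.
  have := edge_adj u v y uv; rewrite (eq_sym u) yu (eq_sym v) yv xu (negbTE uv) =>
      /(_ isT isT).
  by rewrite /= !(mul1r,mul0r,mulr0,addr0,add0r) => h; lra.
have [xv|xv] := eqVneq x v.
  have yv : y != v by rewrite -xv eq_sym.
  rewrite (negbTE yv); have [yu|yu] := eqVneq y u.
    by move: le1; rewrite /= !(mul1r,mul0r,mulr0,addr0,add0r) => h; lra.
  have := edge_adj v u y; rewrite eq_sym uv (eq_sym v) yv (eq_sym u) yu xv =>
      /(_ isT isT isT).
  under eq_bigr do rewrite e_sym.
  by rewrite /= !(mul1r,mul0r,mulr0,addr0,add0r) => h; lra.
rewrite !mul0r.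
have [yu|yu] := eqVneq y u.
  have := edge_adj u v x uv; rewrite (eq_sym u) xu (eq_sym v) xv yu (negbTE uv) =>
      /(_ isT isT).
  under eq_bigr do rewrite (e_sym _ u x).
  by rewrite /= !(mul1r,mul0r,mulr0,addr0,add0r) => h; lra.
have [yv|yv] := eqVneq y v.
  have := edge_adj v u x; rewrite eq_sym uv (eq_sym u) xu (eq_sym v) xv yv =>
      /(_ isT isT isT).
  under eq_bigr do rewrite (e_sym _ v u) (e_sym _ v x).
  by rewrite /= !(mul1r,mul0r,mulr0,addr0,add0r) => h; lra.
have := edge_indep u v x y uv xy xu xv yu yv.
by rewrite /= !addr0 !mul0r !addr0.
Qed.

(** A variance bound for [M]: the excess over [m^2] comes from the four ways of sharing an endpoint
    and the two ways of coinciding. *)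
Let Ex_M2 : Ex (fun G => M G ^+ 2) <= m ^+ 2 + n * (n - 1) * (2 * p + 4 * n * (p * P)).
Proof.
have -> : Ex (fun G => M G ^+ 2) =
    \sum_u \sum_v \sum_x \sum_y Ex (fun G => (e G u v && e G x y)%:R).
  transitivity (Ex (fun G => \sum_u \sum_v \sum_x \sum_y (e G u v && e G x y)%:R)).
    apply: eq_bigr => G _; congr (_ * _).
    rewrite expr2 {1}/M mulr_suml; apply: eq_bigr => u _.
    rewrite mulr_suml; apply: eq_bigr => v _.
    rewrite mulr_sumr; apply: eq_bigr => x _.
    by rewrite mulr_sumr; apply: eq_bigr => y _; rewrite -mulnb natrM.
  by rewrite Ex_sum; apply: eq_bigr => u _; apply: eq_bigr => v _; rewrite Ex_sum.
pose bound (u v x y : V) : R := (x != y)%:R * p ^+ 2 +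
  ((x == u)%:R + (x == v)%:R + (y == u)%:R + (y == v)%:R) * (p * P) +
  ((x == u)%:R * (y == v)%:R + (x == v)%:R * (y == u)%:R) * p.
apply: (@le_trans _ _ (\sum_u \sum_v (u != v)%:R * \sum_x \sum_y bound u v x y)).
  apply: ler_sum => u _; apply: ler_sum => v _.
  have [<-|uv] := eqVneq u v.
    by rewrite mul0r big1// => x _; rewrite big1// => y _; rewrite big1// => G _;
        rewrite e_irr mulr0.
  rewrite mul1r; apply: ler_sum => x _; apply: ler_sum => y _.
  have [<-|xy] := eqVneq x y; last exact: edge_pair.
  rewrite big1; last by move=> G _; rewrite e_irr andbF mulr0.
  by rewrite !addr_ge0// ?mulr_ge0// ?addr_ge0// ?mulr_ge0// ?ltW.
have inner u v : \sum_x \sum_y bound u v x y =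
    n * (n - 1) * p ^+ 2 + (2 * p + 4 * n * (p * P)).
  transitivity (\sum_x ((n - 1) * p ^+ 2 + (n * (x == u)%:R + n * (x == v)%:R + 1 +
      1) * (p * P) +
      ((x == u)%:R + (x == v)%:R) * p)).
    apply: eq_bigr => x _.
    by rewrite !big_split/= -!mulr_suml !big_split/= sum_neq !sumc -!mulr_sumr !sum_eq
        !mulr1.
  by rewrite !big_split/= -!mulr_suml !big_split/= !sumc -!mulr_sumr !sum_eq; ring.
under eq_bigr => u _.
  under eq_bigr do rewrite inner.
  rewrite -mulr_suml sum_neq; over.
rewrite sumc /m le_eqVlt; apply/orP; left; apply/eqP; ring.
Qed.

Let tri_ge0 G u v w : 0 <= tri G u v w. Proof. by rewrite /tri. Qed.

(** Within the triangle [u] has the neighbours [v] and [w], whence the [2]; any other vertex is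
    adjacent to [u] with conditional probability at most [P]. *)
Let Ex_tri_deg u v w : u != v -> u != w -> v != w ->
  Ex (fun G => tri G u v w * (degree (e G) u)%:R) <= (2 + n * P) * Ex (fun G =>
      tri G u v w).
Proof.
move=> uv uw vw; set T := Ex (fun G => tri G u v w).
have T0 : 0 <= T by apply: sumr_ge0 => G _; rewrite mulr_ge0 ?tri_ge0.
have degE G : (degree (e G) u)%:R = \sum_z (e G u z)%:R :> R.
  by rewrite -natr_sum -big_mkcond/= /degree -sum1_card; congr (_%:R);
      apply: eq_bigl => z; rewrite inE.
apply: (@le_trans _ _ (\sum_z ((z == v)%:R * T + (z == w)%:R * T + P * T))); last first.
  by rewrite !big_split/= -!mulr_suml !sum_eq sumr_const -(mulr_natl P) -/n !mul1r
      mulrDl mulr_natl.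
under eq_bigr do rewrite degE mulr_sumr mulr_sumr.
rewrite exchange_big/=; apply: ler_sum => z _.
have PT : 0 <= P * T by rewrite mulr_ge0.
have le1 : Ex (fun G => tri G u v w * (e G u z)%:R) <= T.
  by apply: Ex_le => G; rewrite ler_piMr ?tri_ge0//; case: (e G u z).
have [zv|zv] := eqVneq z v.
  by apply: le_trans le1 _; rewrite mul1r -addrA lerDl addr_ge0// mulr_ge0.
have [zw|zw] := eqVneq z w.
  by apply: le_trans le1 _; rewrite mul0r add0r mul1r lerDl.
rewrite !mul0r !add0r.
have [->|zu] := eqVneq z u; last exact: tri_edge.
by rewrite big1// => G _; rewrite e_irr !mulr0.
Qed.

(** The tangent is linear in the degrees, so only their means given the triangle matter:
    [2 / t - t / t^2 = 1 / t]. *)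
Let Ex_tri_ratio u v w : u != v -> u != w -> v != w ->
  tau / t <= Ex (fun G => tri G u v w * (2 / t - degs G u v / t ^+ 2)).
Proof.
move=> uv uw vw; set T := Ex (fun G => tri G u v w).
have du := Ex_tri_deg u v w uv uw vw.
have dv : Ex (fun G => tri G u v w * (degree (e G) v)%:R) <= (2 + n * P) * T.
  have triC G : tri G u v w = tri G v u w
      by rewrite /tri e_sym -!andbA [e G u w && _]andbC.
  rewrite /T; under eq_bigr do rewrite triC; under [in leRHS]eq_bigr do rewrite triC.
  by apply: Ex_tri_deg; rewrite // eq_sym.
apply: (@le_trans _ _ (T / t)); first by rewrite ler_pM2r ?invr_gt0// tri_prob.
have -> : Ex (fun G => tri G u v w * (2 / t - degs G u v / t ^+ 2)) =
    T * (2 / t) - (Ex (fun G => tri G u v w * (degree (e G) u)%:R) +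
                   Ex (fun G => tri G u v w * (degree (e G) v)%:R)) / t ^+ 2.
  rewrite -big_split/= !mulr_suml -sumrB; apply: eq_bigr => G _.
  by rewrite /degs natrD; ring.
apply: (@le_trans _ _ (T * (2 / t) - (t * T) / t ^+ 2)).
  by rewrite le_eqVlt; apply/orP; left; apply/eqP; field; rewrite ?gt_eqF//.
rewrite lerD2l lerN2 ler_pM2r ?invr_gt0 ?exprn_gt0//.
by rewrite (_ : t * T = (2 + n * P) * T + (2 + n * P) * T) ?lerD//; rewrite /t; ring.
Qed.

Let common_sum G u v : (e G u v)%:R * common G u v = \sum_w tri G u v w.
Proof.
rewrite /common -sum1_card natr_sum mulr_sumr big_mkcond/=.
apply: eq_bigr => w _; rewrite !inE /tri.
by case: (e G u v); case: (e G u w); case: (e G v w); rewrite /= ?mulr1.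
Qed.

Let common_le G u v : common G u v <= degs G u v.
Proof. by rewrite ler_nat (leq_trans (subset_leq_card (finset.subsetIl _ _)))//
    leq_addr. Qed.

(* [1 / d >= 2 / t - d / t ^ 2]: the tangent to the convex [1 / d] at [t]. *)
Let summand_ge G u v : (e G u v)%:R * 2^-1 +
    3^-1 * \sum_w tri G u v w * (2 / t - degs G u v / t ^+ 2) <=
  (e G u v)%:R * (2^-1 + common G u v / (3 * degs G u v)).
Proof.
rewrite mulrDr lerD2l -mulr_suml -common_sum -mulrA mulrCA ler_wpM2l//.
have : 0 <= degs G u v by [].
have := common_le G u v; rewrite le_eqVlt => /[swap].
move=> + _; rewrite le_eqVlt => /predU1P[d0|d0].
  have := common_le G u v; rewrite -d0 => c0.
  have -> : common G u v = 0 by apply/eqP; rewrite eq_le c0/=.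
  by rewrite !(mul0r,mulr0).
rewrite (invfM 3) [leRHS]mulrCA ler_pM2l ?invr_gt0// ler_wpM2l//.
move: (degs G u v) d0 => d d0.
rewrite -subr_ge0 (_ : _ - _ = (d - t) ^+ 2 / (d * t ^+ 2)).
  by rewrite divr_ge0 ?sqr_ge0// mulr_ge0 ?sqr_ge0// ltW.
by field; rewrite ?gt_eqF//. 
Qed.

Let Ex_Y : m / 2 + n * (n - 1) * (n - 2) * (tau / t) / 3 <= Ex Y.
Proof.
pose X G u v w := tri G u v w * (2 / t - degs G u v / t ^+ 2).
have EX u v w : ((u != v) && (u != w) && (v != w))%:R * (tau / t) <= Ex (fun G =>
    X G u v w).
  have [uv|uv] := eqVneq u v.
    by rewrite mul0r sumr_ge0// => G _; rewrite /X /tri uv e_irr !mul0r mulr0.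
  have [uw|uw] := eqVneq u w.
    by rewrite mul0r sumr_ge0// => G _; rewrite /X /tri uw e_irr andbF mul0r mulr0.
  have [vw|vw] := eqVneq v w.
    by rewrite mul0r sumr_ge0// => G _; rewrite /X /tri vw e_irr andbF mul0r mulr0.
  by rewrite mul1r; exact: Ex_tri_ratio.
apply: (@le_trans _ _ (Ex (fun G => \sum_u \sum_v ((e G u v)%:R * 2^-1 +
    3^-1 * \sum_w X G u v w)))); last first.
  by apply: Ex_le => G; apply: ler_sum => u _; apply: ler_sum => v _; exact: summand_ge.
rewrite Ex_sum.
have third (u v : V) : u != v -> \sum_w ((u != v) && (u != w) && (v != w))%:R =
    n - 2 :> R.
  move=> uv; transitivity (\sum_w ((u != w)%:R - (w == v)%:R) : R).
    apply: eq_bigr => w _; rewrite uv (eq_sym v).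
    case: (eqVneq w v) => [->|_]; first by rewrite uv subrr.
    by rewrite andbT subr0.
  by rewrite sumrB/= sum_neq sum_eq; ring.
apply: (@le_trans _ _ (\sum_(u : V) \sum_(v : V) (u != v)%:R * (p / 2 + 3^-1 *
    ((n - 2) * (tau / t))))).
  under eq_bigr do rewrite -mulr_suml sum_neq.
  by rewrite sumc /m; move: (tau / t) => q; rewrite le_eqVlt; apply/orP; left;
      apply/eqP; field.
apply: ler_sum => u _; apply: ler_sum => v _.
have -> : Ex (fun G => (e G u v)%:R * 2^-1 + 3^-1 * \sum_w X G u v w) =
    (u != v)%:R * p / 2 + 3^-1 * \sum_w Ex (fun G => X G u v w).
  rewrite -edge_prob' mulr_suml exchange_big/= mulr_sumr -big_split/=.
  apply: eq_bigr => G _; rewrite -mulr_sumr; ring.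
have S : (u != v)%:R * ((n - 2) * (tau / t)) <= \sum_w Ex (fun G => X G u v w).
  apply: le_trans (ler_sum _ (fun w _ => EX u v w)).
  rewrite -mulr_suml; have [uv|uv] := eqVneq u v;
      last by rewrite -(third u v uv) uv mul1r.
  by rewrite mul0r big1 ?mul0r.
rewrite mulrDr mulrA lerD2l mulrCA ler_pM2l// invr_gt0//.
Qed.

(** Every summand is at most [1/2 + 1/3]. With [Y <= M], exchanging [M] for its mean [m] in the
    denominator costs no more than [|M - m| / m]. *)
Let Y_le_M G : 0 <= Y G <= M G.
Proof.
apply/andP; split.
  apply: sumr_ge0 => u _; apply: sumr_ge0 => v _.
  by rewrite mulr_ge0// addr_ge0 ?invr_ge0// divr_ge0// mulr_ge0.
apply: ler_sum => u _; apply: ler_sum => v _; rewrite ler_piMr//.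
have : common G u v / (3 * degs G u v) <= 3^-1.
  rewrite invfM mulrCA ler_piMr ?invr_ge0//.
  have [->|d0] := eqVneq (degs G u v) 0; first by rewrite invr0 mulr0.
  by rewrite ler_pdivrMr ?mul1r ?common_le// lt_def d0/=.
by lra.
Qed.

Lemma Ex_ratio_ge :
  2^-1 + (n - 2) * tau / (3 * p * t) - eta / 2 -
    (2 + 4 * n * P) / (2 * eta * (n * (n - 1) * p)) <=
  Ex (fun G => overlap_fraction R (e G)).
Proof.
change (2^-1 + (n - 2) * tau / (3 * p * t) - eta / 2 -
  (2 + 4 * n * P) / (2 * eta * (n * (n - 1) * p)) <= Ex (fun G => Y G / M G)).
have ptw G : Y G / m - (eta / 2 + (M G - m) ^+ 2 / (2 * eta * m ^+ 2)) <= Y G / M G.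
  have /andP[Y0 YM] := Y_le_M G.
  (* AM-GM: the deviation of [M] is bounded by its square, whose mean is a variance *)
  have absle : `|M G - m| / m <= eta / 2 + (M G - m) ^+ 2 / (2 * eta * m ^+ 2).
    rewrite -subr_ge0 -(real_normK (num_real (M G - m))); set y := `|_|.
    rewrite (_ : _ - _ = (y - eta * m) ^+ 2 / (2 * eta * m ^+ 2)).
      by rewrite divr_ge0 ?sqr_ge0// !mulr_ge0 ?sqr_ge0// ltW.
    by field; rewrite ?gt_eqF//. 
  apply: le_trans (_ : Y G / m - `|M G - m| / m <= _); first by rewrite lerD2l lerN2.
  have [M0|M0] := eqVneq (M G) 0.
    have -> : Y G = 0 by apply/eqP; rewrite eq_le Y0 -{1}M0 YM.
    by rewrite !mul0r sub0r oppr_le0 divr_ge0// ltW.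
  have {}M0 : 0 < M G by rewrite lt_def M0 (le_trans Y0 YM).
  rewrite -subr_ge0 (_ : _ - _ = (Y G * (m - M G) + M G * `|M G - m|) / (M G * m));
      last first.
    by field; rewrite ?gt_eqF//. 
  rewrite divr_ge0//; last by rewrite mulr_ge0// ltW.
  have h1 : - `|M G - m| <= m - M G by rewrite lerNl opprB ler_norm.
  apply: (@le_trans _ _ (Y G * - `|M G - m| + M G * `|M G - m|)).
    by rewrite mulrN addrC -mulrBl mulr_ge0// subr_ge0.
  by rewrite lerD2r ler_wpM2l.
apply: le_trans (Ex_le _ _ ptw).
(* Since [M] has mean [m], its mean squared deviation is its second moment minus [m^2]. *)
have -> : Ex (fun G => Y G / m - (eta / 2 + (M G - m) ^+ 2 / (2 * eta * m ^+ 2))) =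
    Ex Y / m - eta / 2 - (Ex (fun G => M G ^+ 2) - m ^+ 2) / (2 * eta * m ^+ 2).
  pose q := (2 * eta * m ^+ 2)^-1.
  transitivity (\sum_G (m^-1 * (wt G * Y G) + - q * (wt G * M G ^+ 2) +
      2 * m * q * (wt G * M G) + - (eta / 2 + m ^+ 2 * q) * wt G)).
    by apply: eq_bigr => G _; rewrite -/q; ring.
  by rewrite !big_split/= -!mulr_sumr wt1 Ex_M -/q; ring.
rewrite -addrA -[leRHS]addrA -!opprD lerB//.
  rewrite -(ler_pM2r m_gt0) [leRHS]divfK ?gt_eqF//; apply: le_trans Ex_Y.
  rewrite le_eqVlt; apply/orP; left; apply/eqP; rewrite /m; field.
  by rewrite ?gt_eqF//. 
rewrite lerD2l ler_pdivrMr; last by rewrite !mulr_gt0// exprn_gt0.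
rewrite lerBlDl; apply: le_trans Ex_M2 _.
rewrite lerD2l le_eqVlt; apply/orP; left; apply/eqP; rewrite /m; field.
by rewrite ?gt_eqF//. 
Qed.

End random_graph.

(** * Resampling a coordinate of an i.i.d. sample *)

Section resampling.
Local Open Scope ereal_scope.
Context d (T : measurableType d) (R : realType) (P : probability T R).

Definition upd n (x : n.-tuple T) (i : 'I_n) (y : T) : n.-tuple T :=
  [tuple if j == i then y else tnth x j | j < n].

Lemma tnth_upd n (x : n.-tuple T) i y j :
  tnth (upd n x i y) j = if j == i then y else tnth x j.
Proof. by rewrite tnth_mktuple. Qed.

Lemma measurable_upd n (i : 'I_n) :
  measurable_fun [set: n.-tuple T * T] (fun xy => upd n xy.1 i xy.2).
Proof.
apply/measurable_fun_tnthP => j.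
rewrite (_ : _ \o _ = fun xy => if j == i then xy.2 else tnth xy.1 j).
  by case: eqP => _; [exact: measurable_snd|
    exact: (measurableT_comp (measurable_tnth j) measurable_fst)].
by apply/funext => xy /=; rewrite tnth_upd.
Qed.

Lemma ge0_integral_iidS n (f : n.+1.-tuple T -> \bar R) :
  measurable_fun setT f -> (forall x, 0 <= f x) ->
  \int[iid P n.+1]_x f x = \int[P]_a \int[iid P n]_x f (tuple_consf (a, x)).
Proof.
move=> mf f0 /=; rewrite ge0_integral_distribution//.
rewrite fubini_tonelli1//.
- exact: measurableT_comp.
- by move=> x; exact: f0.
Qed.

(** Replacing one coordinate by a fresh sample preserves the law. This serves as conditioning on all
    coordinates but one. *)
Lemma ge0_integral_iid_resample n (i : 'I_n) (f : n.-tuple T -> \bar R) :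
  measurable_fun setT f -> (forall x, 0 <= f x) ->
  \int[iid P n]_x f x = \int[iid P n]_x \int[P]_y f (upd n x i y).
Proof.
elim: n i f => [[]//|n IH] i f mf f0.
have mfu : measurable_fun setT (fun xy : n.+1.-tuple T * T => f (upd n.+1 xy.1 i xy.2)).
  exact: (measurableT_comp mf (measurable_upd n.+1 i)).
rewrite !ge0_integral_iidS//; last 2 first.
- exact: (measurable_fun_fubini_tonelli_F _ mfu).
- by move=> x; apply: integral_ge0.
have mfc : measurable_fun setT (fun ax : T * n.-tuple T => f (tuple_consf ax)).
  exact: measurableT_comp.
case: (unliftP ord0 i) => [j|] iE.
  apply: eq_integral => a _; rewrite (IH j); last 2 first.
  - exact: (measurableT_comp mfc (pair1_measurable a)).
  - by [].
  apply: eq_integral => x _; apply: eq_integral => y _; congr f.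
  apply: eq_from_tnth => k; rewrite tnth_upd iE.
  case: (unliftP ord0 k) => [l|] ->; rewrite /tuple_consf /=.
    by rewrite !tnthS tnth_upd (inj_eq (@lift_inj _ ord0)).
  by rewrite !tnth0.
(* When the first coordinate is resampled, Tonelli moves its integral inside, and the overwritten
   value contributes the integral of a constant. *)
transitivity (\int[iid P n]_x \int[P]_a f (tuple_consf (a, x))).
  by rewrite -(fubini_tonelli2 _ mfc)// -(fubini_tonelli1 _ mfc).
transitivity (\int[P]_a \int[iid P n]_x \int[P]_y f (tuple_consf (y, x))).
  by rewrite integral_cst//= probability_setT mule1.
apply: eq_integral => a _; apply: eq_integral => x _; apply: eq_integral => y _; congr f.
apply: eq_from_tnth => k; rewrite tnth_upd iE.
case: (unliftP ord0 k) => [l|] ->; rewrite /tuple_consf /=.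
  by rewrite !tnthS.
by rewrite !tnth0.
Qed.

End resampling.
Arguments upd {d T n} x i y.

Section resampled_events.
Local Open Scope ereal_scope.
Context d (T : measurableType d) (R : realType) (P : probability T R) (n : nat).
Implicit Types (A B : set (n.-tuple T)) (E : set (T * T)) (i j : 'I_n).

Lemma measurable_upd_section i A x : measurable A -> measurable [set y | A (upd x i y)].
Proof.
move=> mA; rewrite -[X in measurable X]setTI.
exact: (measurableT_comp (measurable_upd _ _ n i) (pair1_measurable x)).
Qed.

Lemma measurable_upd_prob i A : measurable A ->
  measurable_fun setT (fun x => P [set y | A (upd x i y)]).
Proof.
move=> mA; rewrite (_ : (fun _ => _) = (fun x =>
    P (xsection [set xy | A (upd xy.1 i xy.2)] x))).
  apply: measurable_fun_xsection; rewrite -[X in measurable X]setTI.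
  exact: measurable_upd.
by apply/funext => x; congr (P _); apply/seteqP; split => y /=; rewrite /xsection/= inE.
Qed.

Lemma iid_resampleE i A : measurable A ->
  iid P n A = \int[iid P n]_x P [set y | A (upd x i y)].
Proof.
move=> mA; rewrite -[iid P n A]mul1e -[A in LHS]setIT -integral_indic//.
rewrite mul1e [LHS](ge0_integral_iid_resample _ _ _ P _ i); last 2 first.
- by apply/measurable_EFinP; exact: measurable_indic.
- by move=> x; rewrite lee_fin.
apply: eq_integral => x _.
transitivity (\int[P]_y (\1_[set y | A (upd x i y)] y)%:E); first by [].
by rewrite integral_indic ?setIT//; exact: measurable_upd_section.
Qed.

(** Typically [A] lies in [B] and [B] ignores coordinate [i]; then [c] bounds the conditional
    probability of [A] given the other coordinates. *)
Lemma iid_resample_le i A B (c : R) : measurable A -> measurable B -> (0 <= c)%R ->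
  (forall x y, A (upd x i y) -> B x) ->
  (forall x, P [set y | A (upd x i y)] <= c%:E) ->
  iid P n A <= c%:E * iid P n B.
Proof.
move=> mA mB c0 AB Ac; rewrite (iid_resampleE i)//.
rewrite -[B]setIT -integral_indic// -ge0_integralZl//; last first.
- by apply/measurable_EFinP; exact: measurable_indic.
apply: ge0_le_integral => //.
- exact: measurable_upd_prob.
- by apply: measurable_funeM; apply/measurable_EFinP; exact: measurable_indic.
move=> x _; rewrite indicE; have [xB|xB] := boolP (x \in B); first by rewrite mule1.
rewrite mule0 (_ : [set y | _] = set0) ?measure0//.
by rewrite -subset0 => y /= /AB; rewrite notin_setE in xB.
Qed.

Lemma iid_resample_ge i A B (c : R) : measurable A -> measurable B -> (0 <= c)%R ->
  (forall x, B x -> c%:E <= P [set y | A (upd x i y)]) ->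
  c%:E * iid P n B <= iid P n A.
Proof.
move=> mA mB c0 Ac; rewrite (iid_resampleE i A)//.
rewrite -[B]setIT -integral_indic// -ge0_integralZl//; last first.
- by apply/measurable_EFinP; exact: measurable_indic.
apply: ge0_le_integral => //.
- by move=> x _; rewrite mule_ge0// lee_fin.
- by apply: measurable_funeM; apply/measurable_EFinP; exact: measurable_indic.
- exact: measurable_upd_prob.
move=> x _; rewrite indicE; have [xB|xB] := boolP (x \in B).
  by rewrite mule1; apply: Ac; rewrite inE in xB.
by rewrite mule0.
Qed.

Lemma measurable_pair_event i j E : measurable E ->
  measurable [set x : n.-tuple T | E (tnth x i, tnth x j)].
Proof.
move=> mE; rewrite -[X in measurable X]setTI.
by apply: measurable_fun_pair => //; exact: measurable_tnth.
Qed.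

(** Resampling [j] leaves the measure of a section of [E], a function of coordinate [i] alone;
    resampling [i] then integrates it to the product measure. *)
Lemma iid_pair_indep i j B E : measurable B -> measurable E -> i != j ->
  (forall x y, B (upd x i y) = B x) -> (forall x y, B (upd x j y) = B x) ->
  iid P n (B `&` [set x | E (tnth x i, tnth x j)]) = iid P n B * (P \x P) E.
Proof.
move=> mB mE ij Bi Bj; have mA := measurableI _ _ mB (measurable_pair_event i j _ mE).
rewrite (iid_resampleE j)//.
pose h a := P (xsection E a).
have mh : measurable_fun [set: T] h by exact: measurable_fun_xsection.
have h0 a : 0 <= h a by [].
have mhi : measurable_fun [set: n.-tuple T] (fun x => h (tnth x i)).
  exact: (measurableT_comp mh (measurable_tnth i)).
transitivity (\int[iid P n]_x ((\1_B x)%:E * h (tnth x i))).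
  apply: eq_integral => x _; rewrite indicE; have [xB|xB] := boolP (x \in B).
    rewrite mul1e; congr (P _); apply/seteqP; split => y /=;
        rewrite /xsection/= inE Bj !tnth_upd eqxx (negbTE ij).
      by case.
    by move=> ?; split => //; rewrite inE in xB.
  rewrite mul0e (_ : [set y | _] = set0) ?measure0//.
  by rewrite -subset0 => y /= [+ _]; rewrite Bj; rewrite notin_setE in xB.
rewrite [LHS](ge0_integral_iid_resample _ _ _ P _ i); last 2 first.
- by apply: emeasurable_funM => //; apply/measurable_EFinP; exact: measurable_indic.
- by move=> x; rewrite mule_ge0// lee_fin.
transitivity (\int[iid P n]_x ((\1_B x)%:E * \int[P]_a h a)).
  apply: eq_integral => x _; rewrite -ge0_integralZl//.
  apply: eq_integral => y _; rewrite tnth_upd eqxx; congr (_%:E * _).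
  by rewrite !indicE; congr (nat_of_bool _)%:R; apply/idP/idP; rewrite !inE Bi.
rewrite ge0_integralZr//.
- by rewrite integral_indic// setIT.
- by apply/measurable_EFinP; exact: measurable_indic.
- exact: integral_ge0.
Qed.

End resampled_events.

(** * Areas on the torus *)

Section uniform_circle.
Context (R : realType).
Local Notation U := (uniform_prob (@ltr01 R)).
Implicit Types (a b l h s x y : R).

(** The distribution function of the uniform law on the unit interval. *)
Definition clip (x : R) : R := Num.max 0 (Num.min 1 x).

Lemma clip_id x : 0 <= x <= 1 -> clip x = x.
Proof. by move=> /andP[x0 x1]; rewrite /clip (min_idPr x1) (max_idPr x0). Qed.

(** Three unit ramps laid end to end form one ramp of slope at most one. Hence the three intervals
    of [circle_cover] together have mass at most the length [2 s] of one of them. *)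
Lemma clip_translates x :
  clip (x - 1) + clip x + clip (x + 1) = Num.max 0 (Num.min 3 (x + 1)).
Proof.
have clipP y : (y < 0 /\ clip y = 0) \/ (0 <= y <= 1 /\ clip y =
    y) \/ (1 < y /\ clip y = 1).
  rewrite /clip; have [y1|y1] := leP 1 y.
    rewrite (max_idPr ler01); move: y1; rewrite le_eqVlt => /predU1P[<-|];
        last by right; right.
    by right; left; rewrite ler01 lexx.
  have [y0|y0] := leP 0 y; last by left.
  by right; left; rewrite ltW.
by case: (clipP (x - 1)) => [[h1 ->]|[[/andP[h1 h1'] ->]|[h1 ->]]];
case: (clipP x) => [[h2 ->]|[[/andP[h2 h2'] ->]|[h2 ->]]];
case: (clipP (x + 1)) => [[h3 ->]|[[/andP[h3 h3'] ->]|[h3 ->]]];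
case: (leP 3 (x + 1)) => h4; rewrite ?(max_idPr (ler0n R 3));
    try case: (leP 0 (x + 1)) => h5; lra.
Qed.

Lemma uniform_itvE l h : l <= h -> U `[l, h]%classic = (clip h - clip l)%:E.
Proof.
move=> lh; rewrite /uniform_prob integral_uniform_pdf.
have -> : `[l, h]%classic `&` `[0, 1]%classic = `[Num.max 0 l, Num.min 1 h]%classic :>
    set R.
  apply/seteqP; split => x /=; rewrite !in_itv/=.
    by move=> [/andP[lx xh] /andP[x0 x1]]; rewrite ge_max le_min lx xh x0 x1.
  by rewrite ge_max le_min => /andP[/andP[x0 lx] /andP[x1 xh]]; rewrite lx xh x0 x1.
rewrite (eq_integral (fun=> 1%E)); last first.
  move=> x; rewrite inE/= in_itv/= ge_max le_min => /andP[/andP[x0 _] /andP[x1 _]].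
  by rewrite /uniform_pdf x0 x1/= subr0 invr1.
rewrite integral_cst//= mul1e lebesgue_measure_itv/= lte_fin /clip.
case: ifPn => [lt|].
  rewrite -EFinB; congr (_%:E).
  move: lt; case: (leP 1 h) => h1; case: (leP 1 l) => l1; rewrite ?(max_idPr ler01);
  by case: (leP 0 h) => h0; case: (leP 0 l) => l0; lra.
move=> lt; suff -> : Num.max 0 (Num.min 1 h) - Num.max 0 (Num.min 1 l) = 0 :> R by [].
move: lt; rewrite -leNgt; case: (leP 1 h) => h1; case: (leP 1 l) => l1;
    rewrite ?(max_idPr ler01);
by case: (leP 0 h) => h0; case: (leP 0 l) => l0; lra.
Qed.

Lemma uniform_itvUE (l1 h1 l2 h2 : R) : l1 <= h1 -> h1 < l2 -> l2 <= h2 ->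
  U (`[l1, h1]%classic `|` `[l2, h2]%classic) =
  ((clip h1 - clip l1) + (clip h2 - clip l2))%:E.
Proof.
move=> l1h1 h1l2 l2h2; rewrite EFinD -!uniform_itvE// measureU//.
rewrite -subset0 => x [] /=; rewrite !in_itv/= => /andP[_ xh1] /andP[l2x _].
by move: (le_lt_trans xh1 h1l2); rewrite ltNge l2x.
Qed.

(* All translates of the interval are needed because [a] ranges over the whole line. *)
Definition circle_cover a s : set R :=
  `[a - 1 - s, a - 1 + s]%classic `|` `[a - s, a + s]%classic `|` `[a + 1 - s,
      a + 1 + s]%classic.

(** For reals more than [1] apart [circle_dist] is negative, but its square still enters
    [torus_dist]; hence the absolute value. *)
Lemma circle_cover_dist a s y : `|circle_dist a y| <= s -> circle_cover a s y.
Proof.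
rewrite ler_norml /circle_dist /circle_cover /= !in_itv/= => /andP[].
rewrite le_min ge_min => /andP[_ h1] /orP[|h2].
  by rewrite ler_norml => /andP[? ?]; left; right; apply/andP; split; lra.
case: (leP y a) => ya.
  rewrite ger0_norm ?subr_ge0// in h1 h2.
  by left; left; apply/andP; split; lra.
rewrite ltr0_norm ?subr_lt0// in h1 h2.
by right; apply/andP; split; lra.
Qed.

Lemma measurable_circle_cover a s : measurable (circle_cover a s : set (measurableTypeR
    R)).
Proof. by do 2?[apply: measurableU]; exact: measurable_itv. Qed.

Lemma uniform_circle_cover_le a s : 0 <= s -> (U (circle_cover a s) <= (2 * s)%:E)%E.
Proof.
move=> s0; rewrite /circle_cover.
set A1 := `[a - 1 - s, _]%classic; set A2 := `[a - s, _]%classic;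
    set A3 := `[a + 1 - s, _]%classic.
apply: (@le_trans _ _ (U A1 + U A2 + U A3)%E).
  apply: le_trans (measureU2 _ _ _) _; first by apply: measurableU; exact: measurable_itv.
    exact: measurable_itv.
  by apply: leeD => //; apply: measureU2; exact: measurable_itv.
rewrite !uniform_itvE ?lerD2l; [|lra..].
rewrite -!EFinD lee_fin.
have := clip_translates (a + s); have := clip_translates (a - s).
rewrite (addrAC a (-1) (- s)) (addrAC a (-1) s) (addrAC a 1 (- s)) (addrAC a 1 s)
    /Num.max /Num.min.
by do ! case: ifPn; rewrite -?leNgt; lra.
Qed.

(** Confined to the unit interval, where [circle_dist] is a genuine distance, because arcs serve for
    lower bounds. *)
Definition circle_arc a s : set (measurableTypeR R) :=
    [set y | 0 <= y <= 1 /\ circle_dist a y <= s].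

Lemma circle_distC a b : circle_dist a b = circle_dist b a.
Proof. by rewrite /circle_dist distrC. Qed.

Lemma circle_dist_le a y s : circle_dist a y <= s <->
  (a - s <= y <= a + s) \/ (y <= a - 1 + s) \/ (a + 1 - s <= y).
Proof.
rewrite /circle_dist ge_min ler_norml lerBlDr -lerBlDl.
split.
  move=> /orP[/andP[? ?]|]; first by left; apply/andP; split; lra.
  case: (leP y a) => ya; first by rewrite ger0_norm ?subr_ge0//; right; left; lra.
  by rewrite ltr0_norm ?subr_lt0//; right; right; lra.
move=> [/andP[? ?]|[h|h]]; apply/orP; first by left; apply/andP; split; lra.
  by right; have := ler_norm (a - y); lra.
by right; rewrite distrC; have := ler_norm (y - a); lra.
Qed.

Lemma measurable_circle_dist : measurable_fun [set: measurableTypeR R * measurableTypeR R]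
  (fun xy => circle_dist xy.1 xy.2).
Proof.
have m : measurable_fun [set: measurableTypeR R * measurableTypeR R] (fun xy =>
    `|xy.1 - xy.2| : R).
  by apply: measurableT_comp => //; exact: measurable_funB.
by apply: measurable_minr => //; apply: measurable_funB.
Qed.

Lemma measurable_circle_arc a s : measurable (circle_arc a s).
Proof.
have -> : circle_arc a s = `[0, 1]%classic `&` circle_dist a @^-1` `]-oo, s]%classic.
  by apply/seteqP; split => y /=; rewrite /circle_arc /= !in_itv.
apply: measurableI; first exact: measurable_itv.
rewrite -[X in measurable X]setTI.
exact: (measurableT_comp measurable_circle_dist (pair1_measurable a)).
Qed.

(** The arc is one interval, or two when it crosses the cut at [0 = 1], on either side; [s < 1/2]
    keeps the two pieces disjoint. *)
Lemma uniform_circle_arc_ge a s : 0 <= a <= 1 -> 0 < s < 2^-1 ->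
    ((2 * s)%:E <= U (circle_arc a s))%E.
Proof.
move=> /andP[a0 a1] /andP[s0 s1].
have [as_|as_] := leP s a; last first.
  apply: (@le_trans _ _ (U (`[0, a + s]%classic `|` `[1 + a - s, 1]%classic))).
    rewrite uniform_itvUE; [|lra..].
    by rewrite lee_fin !clip_id; lra.
  apply: le_measure; rewrite ?inE.
  - by apply: measurableU; exact: measurable_itv.
  - exact: measurable_circle_arc.
  move=> y /= []; rewrite in_itv/= => /andP[? ?]; split; rewrite ?circle_dist_le.
  - by apply/andP; split; lra.
  - by left; apply/andP; split; lra.
  - by apply/andP; split; lra.
  - by right; right; lra.
have [as1|as1] := leP a (1 - s).
  apply: (@le_trans _ _ (U `[a - s, a + s]%classic)).
    rewrite uniform_itvE; [|lra..].
    by rewrite lee_fin !clip_id; lra.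
  apply: le_measure; rewrite ?inE; [exact: measurable_itv|exact: measurable_circle_arc|].
  move=> y /=; rewrite in_itv/= => /andP[? ?]; split; rewrite ?circle_dist_le.
    by apply/andP; split; lra.
  by left; apply/andP; split; lra.
apply: (@le_trans _ _ (U (`[0, a + s - 1]%classic `|` `[a - s, 1]%classic))).
  rewrite uniform_itvUE; [|lra..].
  by rewrite lee_fin !clip_id; lra.
apply: le_measure; rewrite ?inE.
- by apply: measurableU; exact: measurable_itv.
- exact: measurable_circle_arc.
move=> y /= []; rewrite in_itv/= => /andP[? ?]; split; rewrite ?circle_dist_le.
- by apply/andP; split; lra.
- by right; left; lra.
- by apply/andP; split; lra.
- by left; apply/andP; split; lra.
Qed.

Lemma uniform_circle_arcI_ge a b s : 0 <= a <= 1 -> 0 <= b <= 1 -> 0 < s < 2^-1 ->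
  circle_dist a b <= s -> (s%:E <= U (circle_arc a s `&` circle_arc b s))%E.
Proof.
wlog ab : a b / a <= b => [hw|].
  case: (leP a b) => [|/ltW] ab a01 b01 s01 dab; first exact: hw.
  by rewrite setIC; apply: hw => //; rewrite circle_distC.
move=> /andP[a0 a1] /andP[b0 b1] /andP[s0 s1] /circle_dist_le dab.
have mA : measurable (circle_arc a s `&` circle_arc b s) by apply: measurableI;
    exact: measurable_circle_arc.
(* Either the centres are close within the interval, and the part of the overlap around them has
   length at least [s], or they are close across the cut, and the overlap contains a piece at each
   end. *)
have [bas|bas] := leP (b - a) s.
  apply: (@le_trans _ _ (U `[Num.max 0 (b - s), Num.min 1 (a + s)]%classic)).
    have m0 : 0 <= Num.max 0 (b - s) <= b by rewrite le_max ge_max lexx/=; lra.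
    have m1 : b <= Num.min 1 (a + s) <= 1 by rewrite le_min ge_min lexx/=; lra.
    have m2 : Num.max 0 (b - s) + s <= Num.min 1 (a + s).
      by rewrite le_min -!lerBrDr !ge_max; lra.
    rewrite uniform_itvE; [|lra..].
    by rewrite lee_fin !clip_id; lra.
  apply: le_measure; rewrite ?inE//.
  move=> y /=; rewrite in_itv/= ge_max le_min => /andP[/andP[? ?] /andP[? ?]].
  split; split; rewrite ?circle_dist_le; first by apply/andP; split.
  - by left; apply/andP; split; lra.
  - by apply/andP; split.
  - by left; apply/andP; split; lra.
have {}dab : a + 1 - s <= b by case: dab => [/andP[]|[]]; lra.
apply: (@le_trans _ _ (U (`[0, b + s - 1]%classic `|` `[a + 1 - s, 1]%classic))).
  rewrite uniform_itvUE; [|lra..].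
  by rewrite lee_fin !clip_id; lra.
apply: le_measure; rewrite ?inE//.
  by apply: measurableU; exact: measurable_itv.
move=> y /= []; rewrite in_itv/= => /andP[? ?]; split; split; rewrite ?circle_dist_le.
- by apply/andP; split; lra.
- by left; apply/andP; split; lra.
- by apply/andP; split; lra.
- by right; left; lra.
- by apply/andP; split; lra.
- by right; right; lra.
- by apply/andP; split; lra.
- by left; apply/andP; split; lra.
Qed.

End uniform_circle.

Arguments clip {R} x.
Arguments circle_cover {R} a s.
Arguments circle_arc {R} a s.

Section torus.
Context (R : realType).
Local Notation point := (measurableTypeR R * measurableTypeR R)%type.
Local Notation mu := (uniform_square R).
Implicit Types (a b c : point) (r s : R).

Lemma torus_distC a b : torus_dist a b = torus_dist b a.
Proof. by rewrite /torus_dist (circle_distC _ a.1) (circle_distC _ a.2). Qed.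

Lemma torus_dist_leE r a b : 0 <= r -> (torus_dist a b <= r) =
  (circle_dist a.1 b.1 ^+ 2 + circle_dist a.2 b.2 ^+ 2 <= r ^+ 2).
Proof.
by move=> r0; rewrite -[in LHS](ger0_norm r0) -sqrtr_sqr ler_sqrt ?sqr_ge0.
Qed.

Lemma measurable_adjacent r : 0 <= r ->
  measurable [set ab : point * point | torus_dist ab.1 ab.2 <= r].
Proof.
move=> r0; pose f (ab : point * point) : R :=
  circle_dist ab.1.1 ab.2.1 ^+ 2 + circle_dist ab.1.2 ab.2.2 ^+ 2.
have mf : measurable_fun setT f.
  apply: measurable_funD; apply: measurable_funX.
    apply: (measurableT_comp (@measurable_circle_dist R)
      (_ : measurable_fun setT (fun ab : point * point => (ab.1.1, ab.2.1)))).
    by apply: measurable_fun_pair; apply: measurableT_comp.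
  apply: (measurableT_comp (@measurable_circle_dist R)
    (_ : measurable_fun setT (fun ab : point * point => (ab.1.2, ab.2.2)))).
  by apply: measurable_fun_pair; apply: measurableT_comp.
rewrite (_ : [set _ | _] = setT `&` f @^-1` `]-oo, r ^+ 2]%classic).
  by apply: mf => //; exact: measurable_itv.
by apply/seteqP; split => ab /=; rewrite in_itv/= torus_dist_leE// => -[].
Qed.

(** The disc is covered by a product of two circle covers of mass at most [2 r] each. The centre is
    any point of the plane, since resampling fixes the other coordinates at arbitrary values. *)
Lemma uniform_square_ball_le r a : 0 <= r ->
  (mu [set b | (torus_dist a b <= r)%R] <= (4 * r ^+ 2)%:E)%E.
Proof.
move=> r0.
have mE : measurable [set b : point | torus_dist a b <= r].
  rewrite -[X in measurable X]setTI.
  exact: (pair1_measurable a measurableT (measurable_adjacent r r0)).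
pose W : set point := circle_cover a.1 r `*` circle_cover a.2 r.
apply: (@le_trans _ _ (mu W)).
  apply: le_measure; rewrite ?inE//.
    by apply: measurableX; exact: measurable_circle_cover.
  move=> b /=; rewrite torus_dist_leE// => ab.
  have sq (x y : R) : x ^+ 2 + y ^+ 2 <= r ^+ 2 -> `|x| <= r.
    move=> xy; rewrite -(ger0_norm r0) -ler_sqr ?nnegrE// !real_normK ?num_real//.
    by apply: le_trans xy; rewrite lerDl sqr_ge0.
  split; apply: circle_cover_dist; first exact: sq ab.
  by rewrite addrC in ab; exact: sq ab.
rewrite /W /= product_measure1E; [|exact: measurable_circle_cover..].
rewrite (_ : 4 * r ^+ 2 = (2 * r) * (2 * r)); last by ring.
by rewrite EFinM; apply: lee_pmul => //; exact: uniform_circle_cover_le.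
Qed.

Definition box a s : set point := circle_arc a.1 s `*` circle_arc a.2 s.

Lemma measurable_box a s : measurable (box a s).
Proof. by apply: measurableX; exact: measurable_circle_arc. Qed.

Definition unit_square : set point := [set a | 0 <= a.1 <= 1 /\ 0 <= a.2 <= 1].

Lemma unit_squareE : unit_square = `[0, 1]%classic `*` `[0, 1]%classic.
Proof. by apply/seteqP; split => a /=; rewrite /unit_square/= !in_itv. Qed.

Lemma measurable_unit_square : measurable unit_square.
Proof. by rewrite unit_squareE; apply: measurableX; exact: measurable_itv. Qed.

Lemma uniform_square_unit : mu unit_square = 1%E.
Proof.
rewrite unit_squareE /= product_measure1E; [|exact: measurable_itv..].
have := uniform_itvE R 0 1 ler01.
by rewrite !clip_id ?lexx ?ler01// subr0 /= => ->; rewrite mule1.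
Qed.

Lemma box_unit a s b : box a s b -> unit_square b.
Proof. by move=> [[? _] [? _]]. Qed.

Lemma box_adjacent r s a b : unit_square a -> box a s b -> 0 <= r ->
    2 * s ^+ 2 <= r ^+ 2 ->
  torus_dist a b <= r.
Proof.
move=> [a1 a2] [/= [b1 d1] [b2 d2]] r0 sr; rewrite torus_dist_leE//.
have cd0 (x y : R) : 0 <= x <= 1 -> 0 <= y <= 1 -> 0 <= circle_dist x y.
  move=> /andP[x0 x1] /andP[y0 y1]; rewrite /circle_dist le_min normr_ge0 subr_ge0
      ler_norml.
  by apply/andP; split; lra.
apply: le_trans sr; rewrite mulr_natl mulr2n.
by apply: lerD; rewrite lerXn2r ?nnegrE ?cd0// ?(le_trans _ d1) ?cd0.
Qed.

Lemma uniform_square_box_ge a s : unit_square a -> 0 < s < 2^-1 ->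
  ((4 * s ^+ 2)%:E <= mu (box a s))%E.
Proof.
move=> [a1 a2] s01; rewrite /box /= product_measure1E; [|exact: measurable_circle_arc..].
rewrite (_ : 4 * s ^+ 2 = (2 * s) * (2 * s)); last by ring.
have s0 : 0 <= 2 * s by lra.
by rewrite EFinM; apply: lee_pmul; rewrite ?lee_fin//; exact: uniform_circle_arc_ge.
Qed.

Lemma uniform_square_boxI_ge a b s : unit_square a -> box a s b -> 0 < s < 2^-1 ->
  ((s ^+ 2)%:E <= mu (box a s `&` box b s))%E.
Proof.
move=> [a1 a2] [/= [b1 d1] [b2 d2]] s01.
have -> : box a s `&` box b s = (circle_arc a.1 s `&` circle_arc b.1 s) `*` (circle_arc
    a.2 s `&` circle_arc b.2 s).
  by rewrite /box setXI.
rewrite /= product_measure1E; [|by apply: measurableI; exact: measurable_circle_arc..].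
have s0 : 0 <= s by lra.
by rewrite expr2 EFinM; apply: lee_pmul; rewrite ?lee_fin//;
    exact: uniform_circle_arcI_ge.
Qed.

Lemma measurable_near s : measurable [set ab : point *
    point | unit_square ab.1 /\ box ab.1 s ab.2].
Proof.
have -> : [set ab : point * point | unit_square ab.1 /\ box ab.1 s ab.2] =
   [set ab | unit_square ab.1] `&` ([set ab | unit_square ab.2] `&`
    ([set ab | circle_dist ab.1.1 ab.2.1 <=
        s] `&` [set ab | circle_dist ab.1.2 ab.2.2 <= s])).
  apply/seteqP; split => ab /=; first by move=> [? [[? ?] [? ?]]].
  by move=> [? [[? ?] [? ?]]].
have mc (f : point * point -> measurableTypeR R * measurableTypeR R) :
    measurable_fun setT f -> measurable [set ab | circle_dist (f ab).1 (f ab).2 <= s].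
  move=> mf; rewrite (_ : [set _ | _] = setT `&` (fun ab =>
      circle_dist (f ab).1 (f ab).2) @^-1` `]-oo, s]%classic).
    apply: (measurableT_comp (@measurable_circle_dist R) mf) => //; exact: measurable_itv.
  by apply/seteqP; split => ab /=; rewrite in_itv//= => -[].
apply: measurableI.
  by rewrite -[X in measurable X]setTI; apply: measurable_fst => //;
      exact: measurable_unit_square.
apply: measurableI.
  by rewrite -[X in measurable X]setTI; apply: measurable_snd => //;
      exact: measurable_unit_square.
apply: measurableI.
  apply: (mc (fun ab => (ab.1.1, ab.2.1))).
  by apply: measurable_fun_pair; apply: measurableT_comp.
apply: (mc (fun ab => (ab.1.2, ab.2.2))).
by apply: measurable_fun_pair; apply: measurableT_comp.
Qed.

End torus.

(** * The random geometric graph *)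

Section finite_expectation.
Context d (T : measurableType d) (R : realType) (P : probability T R) (I : finType).
Variable X : T -> I.
Hypothesis mX : forall i, measurable [set w | X w = i].

Lemma integral_finite_range (f : I -> R) : (forall i, 0 <= f i) ->
  (\int[P]_w (f (X w))%:E = (\sum_i fine (P [set w | X w = i]) * f i)%:E)%E.
Proof.
move=> f0.
transitivity (\int[P]_w \sum_i (f i)%:E * (\1_[set w | X w = i] w)%:E)%E.
  apply: eq_integral => w _; rewrite (bigD1 (X w))//= indicE mem_set// mule1.
  rewrite big1 ?adde0// => i iX; rewrite indicE memNset ?mule0//=.
  by move=> Xi; rewrite Xi eqxx in iX.
rewrite ge0_integral_sum//=; last first.
- by move=> i w _; rewrite mule_ge0// lee_fin.
- move=> i; apply: measurable_funeM; apply/measurable_EFinP; exact: measurable_indic.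
rewrite -sumEFin; apply: eq_bigr => i _.
rewrite ge0_integralZl//=; last first.
- by rewrite lee_fin.
- by apply/measurable_EFinP; exact: measurable_indic.
by rewrite integral_indic// setIT EFinM fineK ?fin_num_measure// muleC.
Qed.

Lemma sum_fiber_prob (a : pred I) :
  \sum_i fine (P [set w | X w = i]) * (a i)%:R = fine (P [set w | a (X w)]).
Proof.
have mA : measurable [set w | a (X w)].
  rewrite (_ : [set _ | _] = \bigcup_(i in [set i | a i]) [set w | X w = i]).
    by apply: fin_bigcup_measurable => // *; exact: finite_finset.
  by apply/seteqP; split => w /=; [move=> aX; exists (X w)|move=> [i /= ai ->]].
apply: EFin_inj; rewrite -integral_finite_range// fineK ?fin_num_measure//.
rewrite -[X in _ = P X]setIT -integral_indic//; apply: eq_integral => w _.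
rewrite indicE; case: (boolP (a (X w))) => aX; first by rewrite mem_set.
by rewrite memNset//; exact/negP.
Qed.

End finite_expectation.

Section uniform_types.
Context (R : realType) (n : nat).

Lemma iid_fair_coin1 (t : n.-tuple bool) :
  (iid (fair_coin R) n [set t] = ((2 ^ n)%:R^-1)%:E)%E.
Proof.
have -> : [set t] = [set x | forall i, [set tnth t i] (tnth x i)].
  apply/seteqP; split => x /=; first by move=> ->.
  by move=> xt; apply: eq_from_tnth.
rewrite (@iidE _ _ _ (fair_coin R) n (fun i => [set tnth t i]))//.
have coin b : fair_coin R [set b] = (2^-1)%:E.
  rewrite /fair_coin /= /bernoulli_prob ifT; last by apply/andP; split; lra.
  by rewrite fsbig_set1 /bernoulli_pmf; case: b; congr (_%:E); field.
under eq_bigr do rewrite coin.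
by rewrite prodEFin prodr_const card_ord natrX exprVn.
Qed.

Lemma sum_tuple_ffun (f : ('I_n -> bool) -> R) :
  \sum_(t : n.-tuple bool) f (tnth t) = \sum_(t : {ffun 'I_n -> bool}) f t.
Proof.
rewrite (reindex (fun t : {ffun 'I_n -> bool} => [tuple t i | i < n])).
  by apply: eq_bigr => t _; congr f; apply/funext => i; rewrite tnth_mktuple.
exists (fun t : n.-tuple bool => [ffun i => tnth t i]) => t _.
  by apply/ffunP => i; rewrite ffunE tnth_mktuple.
by apply: eq_from_tnth => i; rewrite tnth_mktuple ffunE.
Qed.

End uniform_types.

Section geometric_graph_law.
Context (R : realType) (n : nat) (r : R).
Hypotheses (r_gt0 : 0 < r) (r_le : r <= 2^-1).
Local Notation point := (measurableTypeR R * measurableTypeR R)%type.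
Local Notation mu := (uniform_square R).
Local Notation Q := (iid (uniform_square R) n).
Implicit Types (u v w z i j : 'I_n) (x : n.-tuple point).

Let r_ge0 : 0 <= r. Proof. exact: ltW. Qed.

Definition edge_event u v : set (n.-tuple point) :=
  [set x | torus_dist (tnth x u) (tnth x v) <= r].

Lemma measurable_edge_event u v : measurable (edge_event u v).
Proof. exact: (measurable_pair_event _ _ n u v _ (measurable_adjacent R r r_ge0)). Qed.

Definition edge_law : \bar R :=
  (mu \x mu)%E [set ab : point * point | torus_dist ab.1 ab.2 <= r].

Lemma edge_event_upd u v i (b : point) x : i != u -> i != v ->
  edge_event u v (upd x i b) = edge_event u v x.
Proof. by move=> iu iv; rewrite /edge_event/= !tnth_upd eq_sym (negbTE iu) eq_sym
    (negbTE iv). Qed.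

Lemma edge_event_indep u v (B : set (n.-tuple point)) : u != v -> measurable B ->
  (forall x b, B (upd x u b) = B x) -> (forall x b, B (upd x v b) = B x) ->
  (Q (B `&` edge_event u v) = Q B * edge_law)%E.
Proof.
move=> uv mB Bu Bv.
by rewrite -(iid_pair_indep _ _ _ mu n u v B _ mB (measurable_adjacent R r r_ge0) uv Bu
    Bv).
Qed.

Lemma edge_eventE u v : u != v -> (Q (edge_event u v) = edge_law)%E.
Proof.
by move=> uv; rewrite -[edge_event u v]setTI edge_event_indep// probability_setT mul1e.
Qed.

(** Given all points but that of [z], the latter has to fall into the disc around [u]. *)
Lemma edge_event_extend_le u z (B : set (n.-tuple point)) : z != u -> measurable B ->
  (forall x b, B (upd x z b) = B x) ->
  (Q (B `&` edge_event u z) <= (4 * r ^+ 2)%:E * Q B)%E.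
Proof.
move=> zu mB Bz; apply: (iid_resample_le _ _ _ _ _ z) => //.
- by apply: measurableI => //; exact: measurable_edge_event.
- by rewrite mulr_ge0// sqr_ge0.
- by move=> x b []; rewrite Bz.
move=> x; apply: le_trans (uniform_square_ball_le R r (tnth x u) r_ge0).
apply: le_measure; rewrite ?inE.
- apply: (measurable_upd_section _ _ n z) => //.
  by apply: measurableI => //; exact: measurable_edge_event.
- have := pair1_measurable (tnth x u) measurableT (measurable_adjacent R r r_ge0).
  by rewrite setTI.
by move=> b /= [_]; rewrite /edge_event/= !tnth_upd eqxx eq_sym (negbTE zu).
Qed.

Definition triangle u v w := edge_event u v `&` edge_event u w `&` edge_event v w.

Lemma measurable_triangle u v w : measurable (triangle u v w).
Proof. by do 2?[apply: measurableI]; exact: measurable_edge_event. Qed.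

(** The points are placed in turn: [u] in the unit square, [v] in the box around [u], of area at
    least [4 s^2], and [w] in both boxes, an area of at least [s^2]. Boxes of half-side
    [s = r / sqrt 2] fit into the disc, and [4 s^4 = r^4]. *)
Lemma triangle_ge u v w : u != v -> u != w -> v != w ->
    ((r ^+ 4)%:E <= Q (triangle u v w))%E.
Proof.
move=> uv uw vw.
pose s := r / Num.sqrt 2.
have sqrt2 : 0 < Num.sqrt 2 :> R by rewrite sqrtr_gt0.
have s2 : 2 * s ^+ 2 = r ^+ 2.
  by rewrite /s expr_div_n sqr_sqrtr// mulrC divfK.
have s0 : 0 < s by rewrite divr_gt0.
have s01 : 0 < s < 2^-1.
  rewrite s0 ltNge; apply/negP => s_ge.
  have : 2^-1 * 2^-1 <= s * s by rewrite ler_pM// invr_ge0.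
  have : r * r <= 2^-1 * 2^-1 by rewrite ler_pM.
  by move: s2; rewrite !expr2; lra.
pose B1 := [set x | unit_square R (tnth x u)].
pose B2 := [set x | unit_square R (tnth x u) /\ box R (tnth x u) s (tnth x v)].
have mB1 : measurable B1.
  rewrite -[X in measurable X]setTI.
  by apply: measurable_tnth => //; exact: measurable_unit_square.
have mB2 : measurable B2 by exact: (measurable_pair_event _ _ n u v _ (measurable_near
    R s)).
have Q1 : (1%:E <= Q B1)%E.
  apply: (@le_trans _ _ (1%:E * Q setT)%E); first by rewrite probability_setT mule1.
  apply: (iid_resample_ge _ _ _ _ _ u) => // x _.
  rewrite (_ : [set y | _] = unit_square R) ?uniform_square_unit//.
  by apply/seteqP; split => y; rewrite /B1/= tnth_upd eqxx.
have Q2 : ((4 * s ^+ 2)%:E <= Q B2)%E.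
  apply: (@le_trans _ _ ((4 * s ^+ 2)%:E * Q B1)%E).
    by rewrite -[X in (X <= _)%E]mule1 lee_pmul// lee_fin mulr_ge0// sqr_ge0.
  apply: (iid_resample_ge _ _ _ _ _ v) => //; first by rewrite mulr_ge0// sqr_ge0.
  move=> x B1x; apply: le_trans (uniform_square_box_ge R _ _ B1x s01) _.
  apply: le_measure; rewrite ?inE; first exact: measurable_box.
    exact: (measurable_upd_section _ _ n v).
  by move=> y; rewrite /B2/= !tnth_upd eqxx (negbTE uv).
apply: (@le_trans _ _ ((s ^+ 2)%:E * Q B2)%E).
  rewrite (_ : r ^+ 4 = s ^+ 2 * (4 * s ^+ 2)); last first.
    by rewrite (_ : 4%N = (2 * 2)%N)// exprM -s2; ring.
  by rewrite EFinM lee_pmul// lee_fin ?mulr_ge0 ?sqr_ge0.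
apply: (iid_resample_ge _ _ _ _ _ w) => //; [exact: measurable_triangle|exact: sqr_ge0|].
move=> x [xu xv]; apply: le_trans (uniform_square_boxI_ge R _ _ _ xu xv s01) _.
apply: le_measure; rewrite ?inE.
- by apply: measurableI; exact: measurable_box.
- by apply: (measurable_upd_section _ _ n w); exact: measurable_triangle.
move=> y [yu yv]; rewrite /triangle /edge_event/= !tnth_upd eqxx (negbTE uw) (negbTE vw).
have rs : 2 * s ^+ 2 <= r ^+ 2 by rewrite s2.
do 2?split; apply: (box_adjacent R r s) => //.
exact: box_unit xv.
Qed.

(** A finite code of the graph, which turns expectations over the positions into finite weighted
    sums. *)
Definition graph_code x : {ffun 'I_n * 'I_n -> bool} :=
  [ffun uv => geometric_graph r x uv.1 uv.2].

(* Symmetrized, and loops removed, so that every code denotes a simple graph. *)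
Definition graph_of (G : {ffun 'I_n * 'I_n -> bool}) : rel 'I_n :=
  fun u v => (u != v) && (G (u, v) || G (v, u)).

Lemma graph_of_sym G : symmetric (graph_of G).
Proof. by move=> u v; rewrite /graph_of eq_sym orbC. Qed.

Lemma graph_of_irr G : irreflexive (graph_of G).
Proof. by move=> u; rewrite /graph_of eqxx. Qed.

Lemma graph_codeK x : graph_of (graph_code x) = geometric_graph r x.
Proof.
apply/funext => u; apply/funext => v;
    rewrite /graph_of !ffunE /geometric_graph/= torus_distC.
by rewrite (eq_sym v u); case: eqP => //= _; rewrite orbb.
Qed.

Lemma geometric_graphE x u v : u != v -> geometric_graph r x u v <-> edge_event u v x.
Proof. by move=> uv; rewrite /geometric_graph uv. Qed.

Lemma measurable_graph_code G : measurable [set x | graph_code x = G].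
Proof.
have -> : [set x | graph_code x = G] =
    \bigcap_(uv : 'I_n * 'I_n) [set x | geometric_graph r x uv.1 uv.2 = G uv].
  apply/seteqP; split => x /=; first by move=> <- uv _ /=; rewrite ffunE.
  by move=> xG; apply/ffunP => uv; rewrite ffunE; exact: xG.
apply: fin_bigcap_measurable => [|[u v] _]; first exact: finite_finset.
have mg : measurable [set x | geometric_graph r x u v].
  have [<-|uv] := eqVneq u v.
    rewrite (_ : [set _ | _] = set0)//; apply/seteqP; split => x //=.
    by rewrite /geometric_graph eqxx.
  rewrite (_ : [set _ | _] = edge_event u v); first exact: measurable_edge_event.
  by apply/seteqP; split => x /=; rewrite geometric_graphE.
case: (G (u, v)); first exact: mg.
rewrite (_ : [set _ | _] = ~` [set x | geometric_graph r x u v]);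
    first exact: measurableC.
by apply/seteqP; split => x /=; [move=> ->|move/negP/negbTE].
Qed.

End geometric_graph_law.

Section geometric_graph_ratio.
Context (R : realType) (n : nat) (r : R).
Hypotheses (r_gt0 : 0 < r) (r_le : r <= 2^-1) (n_ge3 : (3 <= n)%N).
Local Notation Q := (iid (uniform_square R) n).
Local Notation graph := {ffun 'I_n * 'I_n -> bool}.

Definition graph_weight (G : graph) : R := fine (Q [set x | graph_code R n r x = G]).

Let prob_fin A : measurable A -> Q A \is a fin_num.
Proof. by move=> mA; exact: fin_num_measure. Qed.

Lemma sum_graph_weight (a : pred graph) A : [set x | a (graph_code R n r x)] = A ->
  \sum_G graph_weight G * (a G)%:R = fine (Q A).
Proof.
move=> <-; apply: sum_fiber_prob => G; exact: measurable_graph_code.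
Qed.

Let adj u v : u != v -> [set x | graph_of n (graph_code R n r x) u v] =
    edge_event R n r u v.
Proof.
by move=> uv; apply/seteqP; split => x /=; rewrite graph_codeK geometric_graphE.
Qed.

Let madj u v : measurable (edge_event R n r u v).
Proof. exact: measurable_edge_event. Qed.

Let p : R := fine (edge_law R r).

Let edge_prob u v : u != v -> fine (Q (edge_event R n r u v)) = p.
Proof. by move=> uv; rewrite edge_eventE. Qed.

Let p_fin : edge_law R r \is a fin_num.
Proof.
have i01 : (Ordinal (ltnW n_ge3)) != (Ordinal n_ge3) :> 'I_n by [].
by rewrite -(edge_eventE _ n r r_gt0 _ _ i01); exact: prob_fin.
Qed.

Let fine_le A B : measurable A -> measurable B -> A `<=` B -> fine (Q A) <= fine (Q B).
Proof.
by move=> mA mB AB; apply: fine_le; rewrite ?prob_fin//; apply: le_measure; rewrite ?inE.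
Qed.

Let extend_le u z B : z != u -> measurable B -> (forall x b, B (upd x z b) = B x) ->
  fine (Q (B `&` edge_event R n r u z)) <= (4 * r ^+ 2) * fine (Q B).
Proof.
move=> zu mB Bz; rewrite -lee_fin EFinM !fineK ?prob_fin//; last exact: measurableI.
exact: edge_event_extend_le.
Qed.

Let tri_set u v w : u != v -> u != w -> v != w ->
  [set x | let G := graph_code R n r x in [&& graph_of n G u v,
      graph_of n G u w & graph_of n G v w]] =
  triangle R n r u v w.
Proof.
move=> uv uw vw; rewrite /triangle -!adj//; apply/seteqP; split => x /=.
  by move=> /and3P[].
by move=> [[-> ->] ->].
Qed.

Let triE G u v w : tri (graph_of n) G u v w =
  [&& graph_of n G u v, graph_of n G u w & graph_of n G v w]%:R :> R.
Proof. by rewrite /tri andbA. Qed.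

Let tri_ge u v w : u != v -> u != w -> v != w ->
    r ^+ 4 <= fine (Q (triangle R n r u v w)).
Proof.
move=> uv uw vw; rewrite -lee_fin fineK ?prob_fin ?triangle_ge//.
exact: measurable_triangle.
Qed.

Let edge2_le u v z : u != v -> u != z -> v != z ->
  fine (Q (edge_event R n r u v `&` edge_event R n r u z)) <= p * (4 * r ^+ 2).
Proof.
move=> uv uz vz; rewrite mulrC -(edge_prob u v uv); apply: extend_le => //;
    first by rewrite eq_sym.
by move=> x b; rewrite edge_event_upd// eq_sym.
Qed.

(** The lower bound needs no further area: a triangle contains two edges at a common vertex, so
    [r^4 <= p * (4 * r ^ 2)]. *)
Lemma edge_law_bounds : r ^+ 2 / 4 <= p <= 4 * r ^+ 2.
Proof.
pose i0 : 'I_n := Ordinal (ltnW (ltnW n_ge3)).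
pose i1 : 'I_n := Ordinal (ltnW n_ge3).
pose i2 : 'I_n := Ordinal n_ge3.
have r2 : 0 < r ^+ 2 by rewrite exprn_gt0.
apply/andP; split.
  have le : r ^+ 4 <= p * (4 * r ^+ 2).
    apply: le_trans (edge2_le i0 i1 i2 isT isT isT).
    apply: le_trans (tri_ge i0 i1 i2 isT isT isT) _.
    apply: fine_le; [exact: measurable_triangle|exact: measurableI|].
    by move=> x [].
  rewrite ler_pdivrMr// -(ler_pM2r r2); apply: le_trans (le_trans le _).
    by rewrite -exprD.
  by rewrite mulrA.
have := extend_le i0 i1 setT isT measurableT (fun _ _ => erefl).
by rewrite setTI edge_prob// probability_setT mulr1.
Qed.

(** The abstract estimate with [P = 4 r^2] from discs and [tau = r^4] from boxes. *)
Lemma graph_ratio_ge (eta : R) : 0 < eta ->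
  2^-1 + (n%:R - 2) * r ^+ 4 / (3 * p * (4 + 2 * n%:R * (4 * r ^+ 2))) - eta / 2 -
    (2 + 4 * n%:R * (4 * r ^+ 2)) / (2 * eta * (n%:R * (n%:R - 1) * p)) <=
  \sum_G graph_weight G * overlap_fraction R (graph_of n G).
Proof.
move=> eta0.
have Ex1 u v : u != v -> \sum_G graph_weight G * (graph_of n G u v)%:R = p.
  by move=> uv; rewrite (sum_graph_weight (fun G =>
      graph_of n G u v) _ (adj u v uv)) edge_prob.
have Ex2 u v x y : u != v -> x != y ->
    \sum_G graph_weight G * (graph_of n G u v && graph_of n G x y)%:R =
    fine (Q (edge_event R n r u v `&` edge_event R n r x y)).
  move=> uv xy; apply: (sum_graph_weight (fun G => graph_of n G u v && graph_of n G x y)).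
  by rewrite -!adj//; apply/seteqP; split => z /=; [move=> /andP|move=> [-> ->]].
have Ex3 u v w : u != v -> u != w -> v != w ->
    \sum_G graph_weight G * tri (graph_of n) G u v w = fine (Q (triangle R n r u v w)).
  move=> uv uw vw; under eq_bigr do rewrite triE.
  exact: (sum_graph_weight (fun G => [&& graph_of n G u v,
      graph_of n G u w & graph_of n G v w])
     _ (tri_set u v w uv uw vw)).
have P0 : 0 < 4 * r ^+ 2 by rewrite mulr_gt0// exprn_gt0.
have p0 : 0 < p.
  by have /andP[+ _] := edge_law_bounds; apply: lt_le_trans; rewrite divr_gt0// exprn_gt0.
have := @Ex_ratio_ge R 'I_n graph graph_weight (graph_of n).
move=> /(_ _ _ (graph_of_sym n) (graph_of_irr n) p (4 *
    r ^+ 2) (r ^+ 4) eta p0 (ltW P0) eta0).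
rewrite card_ord; apply.
- by move=> G; exact: fine_ge0.
- have := sum_graph_weight predT setT.
  rewrite probability_setT /= => <-; first by apply: eq_bigr => G _; rewrite mulr1.
  by apply/seteqP.
- exact: ltnW.
- exact: Ex1.
- move=> u v x y uv xy xu xv yu yv; rewrite Ex2// edge_event_indep//.
  + by rewrite fineM ?prob_fin// edge_prob// expr2.
  + by move=> z b; rewrite edge_event_upd.
  + by move=> z b; rewrite edge_event_upd.
- by move=> u v z uv uz vz; rewrite Ex2// edge2_le.
- by move=> u v w uv uw vw; rewrite Ex3// tri_ge.
move=> u v w z uv uw vw zu zv zw; rewrite Ex3//.
have := extend_le u z (triangle R n r u v w) zu (measurable_triangle _ _ _ r_gt0 u v w).
have inv x b : triangle R n r u v w (upd x z b) = triangle R n r u v w x.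
  by rewrite /triangle /setI /= !edge_event_upd.
move=> /(_ inv); apply: le_trans; rewrite le_eqVlt; apply/orP; left; apply/eqP.
rewrite -(sum_graph_weight (fun G => [&& graph_of n G u v,
    graph_of n G u w & graph_of n G v w] && graph_of n G u z)).
  by apply: eq_bigr => G _; rewrite triE -natrM mulnb.
rewrite -tri_set// -adj 1?eq_sym//; apply/seteqP; split => x /=; first by move=> /andP.
by move=> [-> ->].
Qed.

End geometric_graph_ratio.

(** * Numerical evaluation of the bound *)

Section ratio_bound.
Context (R : realType).

(* [10 ^ 8] and [4000] are written as products because ring numerals unfold to unary
   numbers. *)
Lemma ratio_bound_ge (n r p : R) : 100 * (100 * (100 * 100)) <= n -> 0 < r ->
    2^-1 <= n * r ^+ 2 ->
  r ^+ 2 / 4 <= p <= 4 * r ^+ 2 ->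
  2^-1 + 9 / 3200 <= 2^-1 + (n - 2) * r ^+ 4 / (3 * p * (4 + 2 * n * (4 * r ^+ 2))) -
    1000^-1 / 2 - (2 + 4 * n * (4 * r ^+ 2)) / (2 * 1000^-1 * (n * (n - 1) * p)).
Proof.
move=> n_ge r0; rewrite (_ : r ^+ 4 = r ^+ 2 * r ^+ 2); last by rewrite -exprD.
have : 0 < r ^+ 2 by rewrite exprn_gt0.
move: (r ^+ 2) => q q0 nq /andP[pq_ge pq_le].
have n0 : 0 < n by lra.
have p0 : 0 < p by lra.
have t0 : 0 < 4 + 8 * (n * q) by lra.
(* From [p <= 4 q] and [4 <= 8 n q] the denominator is at most [12 q * 16 n q = 192 n q^2]. *)
have main : (n - 2) / (192 * n) <= (n - 2) * (q * q) / (3 * p * (4 + 2 * n * (4 * q))).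
  rewrite (_ : 4 + 2 * n * (4 * q) = 4 + 8 * (n * q)); last by ring.
  rewrite -!mulrA ler_pM2l; last by lra.
  rewrite mulrA ler_pdivlMr ?mulr_gt0//.
  rewrite ler_pdivrMl ?mulr_gt0//.
  have h1 : 3 * (p * (4 + 8 * (n * q))) <= 3 * (4 * q * (4 + 8 * (n * q))).
    by rewrite ler_pM2l// ler_pM2r.
  apply: le_trans h1 _.
  have : q * 2^-1 <= q * (n * q) by rewrite ler_pM2l.
  by nra.
have n1 : 0 < n - 1 by lra.
(* Here [2 + 16 n q <= 20 n q] because [n q >= 1/2], and [20 n q <= 80 n p] because [p >= q / 4]. *)
have err (eta : R) : 0 < eta ->
    (2 + 4 * n * (4 * q)) / (2 * eta * (n * (n - 1) * p)) <= 40 / (eta * (n - 1)).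
  move=> eta0.
  rewrite ler_pdivrMr; last by rewrite !mulr_gt0.
  rewrite (_ : 40 / _ * _ = 80 * (n * p)); last by field; rewrite !gt_eqF.
  have : n * (q / 4) <= n * p by rewrite ler_pM2l.
  by nra.
have e1 : 40 / (1000^-1 * (n - 1)) <= 2 / (40 * 100).
  by rewrite ler_pdivrMr; lra.
have e0 := err 1000^-1 ltac:(lra).
have e2 : 192^-1 - (80 * 100)^-1 <= (n - 2) / (192 * n).
  by rewrite ler_pdivlMr; lra.
(* What remains is [1/192 - 1/8000 - 1/2000 - 1/2000 >= 9/3200]. *)
by lra.
Qed.

End ratio_bound.

(** * Averaging over positions, types and coins *)

Section fsp_expectation.
Context (R : realType) (n : nat) (r : R).
Hypotheses (r_gt0 : 0 < r).
Local Notation graph := {ffun 'I_n * 'I_n -> bool}.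
Local Notation outcome := (graph * n.-tuple bool * n.-tuple bool)%type.
Local Notation point := (measurableTypeR R * measurableTypeR R)%type.

Let code (w : n.-tuple point * n.-tuple bool * n.-tuple bool) : outcome :=
  (graph_code R n r w.1.1, w.1.2, w.2).

Let code_fiber (o : outcome) : [set w | code w = o] =
  ([set x | graph_code R n r x = o.1.1] `*` [set o.1.2]) `*` [set o.2].
Proof.
by case: o => [[G t] c]; apply/seteqP; split => -[[x t'] c'] /=; rewrite /code/=;
    [case|case; case] => -> -> ->.
Qed.

Let measurable_types (t : n.-tuple bool) : measurable [set t].
Proof.
have -> : [set t] = \bigcap_(i : 'I_n) [set x : n.-tuple bool | tnth x i = tnth t i].
  apply/seteqP; split => x /=; first by move=> ->.
  by move=> xt; apply: eq_from_tnth => i; exact: xt.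
apply: fin_bigcap_measurable => [|i _]; first exact: finite_finset.
rewrite -[X in measurable X]setTI.
have m1 : measurable [set tnth t i] by [].
exact: (@measurable_tnth _ bool n i measurableT _ m1).
Qed.

(** The fraction depends on the outcome only through the graph, the types and the coins. Their joint
    law has weight [graph_weight * z * z], so the bound for a fixed graph applies graph by graph. *)
Lemma fsp_expectation_ge : 
  ((\sum_G graph_weight R n r G * overlap_fraction R (graph_of n G))%:E <=
   'E_(fsp_prob R n)[fsp_monochrome_fraction r])%E.
Proof.
pose f (o : outcome) : R := monochrome_fraction (graph_of n o.1.1) R
  (fsp (graph_of n o.1.1) (tnth o.1.2) (tnth o.2)).
have fE w : fsp_monochrome_fraction r w = f (code w).
  by rewrite /fsp_monochrome_fraction /f /code /= graph_codeK.
have f0 o : 0 <= f o by rewrite /f /monochrome_fraction divr_ge0.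
have mfib o : measurable [set w | code w = o].
  rewrite code_fiber; apply: measurableX => //; apply: measurableX => //.
  exact: measurable_graph_code.
rewrite expectation.unlock; under eq_integral do rewrite fE.
rewrite (integral_finite_range _ _ _ (fsp_prob R n) _ code)//.
pose z : R := ((2 ^ n)%:R)^-1.
have fibE (o : outcome) : fine (fsp_prob R n [set w | code w = o]) =
    graph_weight R n r o.1.1 * (z * z).
  rewrite code_fiber; set A := [set x | _].
  have mA : measurable A by exact: measurable_graph_code.
  have -> : fsp_prob R n ((A `*` [set o.1.2]) `*` [set o.2]) =
      (iid (uniform_square R) n A * iid (fair_coin R) n [set o.1.2] *
          iid (fair_coin R) n [set o.2])%E.
    transitivity ((iid (uniform_square R) n \x iid (fair_coin R) n)%E (A `*` [set
        o.1.2]) *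
        iid (fair_coin R) n [set o.2])%E.
      by apply: product_measure1E => //; exact: measurableX.
    by congr (_ * _)%E; exact: product_measure1E.
  rewrite !iid_fair_coin1 -/z -muleA -EFinM.
  by rewrite fineM// fin_num_measure.
rewrite lee_fin.
have z1 : z * z * #|{ffun 'I_n -> bool}|%:R ^+ 2 = 1.
  by rewrite card_ffun card_bool card_ord /z expr2 mulrACA mulVf ?mulr1// pnatr_eq0
      -lt0n expn_gt0.
apply: (@le_trans _ _ (\sum_G graph_weight R n r G * (z * z *
    \sum_(t : {ffun 'I_n -> bool}) \sum_(c : {ffun 'I_n -> bool})
      monochrome_fraction (graph_of n G) R (fsp (graph_of n G) t c)))).
  apply: ler_sum => G _; apply: ler_wpM2l; first exact: fine_ge0.
  have zz0 : 0 <= z * z by rewrite mulr_ge0 ?invr_ge0.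
  apply: le_trans (ler_wpM2l zz0 (@sum_monochrome_fraction_ge R _ _ (graph_of_sym n G)
      (graph_of_irr n G))).
  by rewrite [leRHS]mulrA [X in _ <= X * _](_ : _ = 1) ?mul1r//; exact: z1.
rewrite le_eqVlt; apply/orP; left; apply/eqP.
under [RHS]eq_bigr do rewrite fibE.
rewrite -(pair_big predT predT (fun Gt c => graph_weight R n r Gt.1 * (z * z) *
  monochrome_fraction (graph_of n Gt.1) R (fsp (graph_of n Gt.1) (tnth Gt.2) (tnth
      c))))/=.
rewrite -(pair_big predT predT (fun G t =>
    \sum_(c : n.-tuple bool) graph_weight R n r G * (z * z) *
  monochrome_fraction (graph_of n G) R (fsp (graph_of n G) (tnth t) (tnth c))))/=.
apply: eq_bigr => G _; rewrite mulrA -(sum_tuple_ffun R n (fun t =>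
    \sum_(c : {ffun 'I_n -> bool})
  monochrome_fraction (graph_of n G) R (fsp (graph_of n G) t c))).
rewrite mulr_sumr; apply: eq_bigr => t _.
rewrite -(sum_tuple_ffun R n (fun c =>
    monochrome_fraction (graph_of n G) R (fsp (graph_of n G) (tnth t) c))).
by rewrite mulr_sumr.
Qed.

End fsp_expectation.


Theorem theorem6 (R : realType) (r : nat -> R)
    (r_gt0 : forall n, (2 <= n)%N -> 0 < r n)
    (deg_ge2 : forall n, (2 <= n)%N -> 2 <= expected_avg_degree n (r n))
    (deg_littleo : (fun n => expected_avg_degree n (r n) : R^o)
                     =o_\oo (fun n => Num.sqrt (n%:R : R) : R^o)) :
  exists eps : nat -> R,
    eps @ \oo --> (0 : R) /\
    \forall n \near \oo,
      ((2^-1 +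
        9 / 800 *
        (2^-1 - (Num.sqrt (2 * pi *
                   (Num.floor (expected_avg_degree n (r n) / 2))%:~R))^-1) ^+ 2 *
        (1 - expR (- (expected_avg_degree n (r n) / 2)) *
             (1 + expected_avg_degree n (r n) / 2)) *
        (1 - eps n))%:E
       <= 'E_(fsp_prob R n)[fsp_monochrome_fraction (r n)])%E.
Proof.
(* Zero suffices, since the claimed gain is at most [9/800 * 1/4 = 9/3200]. *)
exists (fun=> 0); split; first exact: cvg_cst.
have deg_le : \forall n \near \oo,
    expected_avg_degree n (r n) <= Num.sqrt (n%:R : R).
  have /eqoP/(_ 1 ltr01) := deg_littleo; apply: filterS => n.
  by rewrite mul1r (ger0_norm (sqrtr_ge0 _)); apply: le_trans; exact: ler_norm.
have n_large : \forall n \near \oo, 100 * (100 * (100 * 100)) <= (n%:R : R).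
  exact: nbhs_infty_ger.
near=> n.
have n3 : (3 <= n)%N by near: n; exact: nbhs_infty_ge.
have dle : expected_avg_degree n (r n) <= Num.sqrt (n%:R : R) by near: n.
have nl : 100 * (100 * (100 * 100)) <= (n%:R : R) by near: n.
have r0 := r_gt0 n (ltnW n3); have dge := deg_ge2 n (ltnW n3).
rewrite subr0 mulr1.
move: dle dge; rewrite {1 2}/expected_avg_degree;
    set D := expected_avg_degree _ _ => dle dge.
have pi2 := @pi_ge2 R.
have pi4 : (pi : R) <= 4 by have [/andP[_]] := @pihalf_02_cos_pihalf R; lra.
have r2 : 0 < r n ^+ 2 by rewrite exprn_gt0.
have sq : Num.sqrt (n%:R : R) ^+ 2 = n%:R by rewrite sqr_sqrtr.
have n1 : 0 <= n%:R - 1 :> R by lra.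
(* An expected degree of at least [2], together with [pi <= 4], gives [(n - 1) r^2 >= 1/2]. *)
have nr : 2^-1 <= n%:R * r n ^+ 2.
  have : (n%:R - 1) * pi * r n ^+ 2 <= (n%:R - 1) * 4 * r n ^+ 2.
    by rewrite ler_pM2r// ler_wpM2l.
  by lra.
(* The growth assumption enters here: [r > 1/2] would make the expected degree at least
   [(n - 1) / 2], which exceeds [sqrt n]. *)
have r_le : r n <= 2^-1.
  rewrite leNgt; apply/negP => r_gt.
  have q_ge : 4^-1 <= r n ^+ 2.
    have : 2^-1 * 2^-1 <= r n * r n by rewrite ler_pM// ?invr_ge0// ltW.
    by rewrite expr2; lra.
  have : (n%:R - 1) * 2 * 4^-1 <= (n%:R - 1) * pi * r n ^+ 2.
    by rewrite ler_pM ?mulr_ge0 ?invr_ge0// ler_wpM2l.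
  move: sq dle (sqrtr_ge0 (n%:R : R)); set y := Num.sqrt _ => sq dle y0 h.
  have : (y - 1) ^+ 2 <= 2 by rewrite sqrrB1 sq; lra.
  have : 3 ^+ 2 <= (y - 1) ^+ 2; last by lra.
  have y100 : 100 <= y.
    rewrite leNgt; apply/negP => y_lt; have : y * y <= 100 * 100 by rewrite ler_pM// ltW.
    by rewrite -expr2 sq; lra.
  by rewrite lerXn2r ?nnegrE//; lra.
have lower : ((2^-1 + 9 / 3200)%:E <= 'E_(fsp_prob R n)[fsp_monochrome_fraction (r n)])%E.
  apply: le_trans (fsp_expectation_ge R n (r n) r0).
  rewrite lee_fin.
  apply: le_trans (graph_ratio_ge R n (r n) r0 r_le n3 1000^-1 _).
    exact: (ratio_bound_ge R _ _ _ nl r0 nr (edge_law_bounds R n (r n) r0 r_le n3)).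
  by rewrite invr_gt0 ltr0n.
apply: le_trans lower; rewrite lee_fin lerD2l.
have D2 : 1 <= D / 2 by rewrite ler_pdivlMr// mul1r.
set x := (Num.sqrt _)^-1.
(* As [D >= 2], the floor is at least [1]; so the square root is at least [1], [x] lies in the unit
   interval, and [(1/2 - x)^2 <= 1/4]. *)
have k1 : 1 <= (Num.floor (D / 2))%:~R :> R by rewrite ler1z floor_ge_int.
have pik : 1 <= 2 * pi * (Num.floor (D / 2))%:~R :> R.
  have : 2 * pi * 1 <= 2 * pi * (Num.floor (D / 2))%:~R :> R by rewrite ler_pM2l//; lra.
  by lra.
have x01 : 0 <= x <= 1.
  have s1 : 1 <= Num.sqrt (2 * pi * (Num.floor (D / 2))%:~R) :> R.
    by rewrite -[leLHS]sqrtr1 ler_sqrt//; lra.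
  by rewrite /x invr_ge0 sqrtr_ge0/= invf_le1 ?(lt_le_trans ltr01 s1).
have A_le : (2^-1 - x) ^+ 2 <= 4^-1 by rewrite expr2; nra.
have B_le : 1 - expR (- (D / 2)) * (1 + D / 2) <= 1.
  by rewrite gerBl mulr_ge0 ?expR_ge0//; lra.
have : (2^-1 - x) ^+ 2 * (1 - expR (- (D / 2)) * (1 + D / 2)) <= (2^-1 - x) ^+ 2.
  by rewrite ler_piMr// sqr_ge0.
by rewrite -mulrA; lra.
Unshelve. all: by end_near.
Qed.
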